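(* Let $f\in\Lambda_n$ be a Schur positive symmetric function. If $f$ is flip-symmetric with offset $r$, then both $s_{1,1}\circ f$ and $s_2\circ f$ are Schur positive symmetric functions in $\Lambda_{2n}$ which are flip-symmetric with offset $2r-2$.
   Context: Let $\Lambda=\mathbb{Q}[p_1,p_2,\dots]$ be the algebra of symmetric functions, $\Lambda_n$ its homogeneous component of degree $n$, with power sums $p_k$ and Schur functions $s_\lambda$; $s_2=s_{(2)}$ and $s_{1,1}=s_{(1,1)}$. A symmetric function is Schur positive if its coefficients in the Schur basis are non-negative integers. The plethysm $\circ$ is determined by: $p_n\circ p_m=p_{nm}$; for each $f\in\Lambda$ the map $g\mapsto g\circ f$ is an algebra homomorphism; and $p_n\circ f=f\circ p_n$ (so $p_n\circ f$ is obtained from $f$ by replacing each $p_m$ by $p_{nm}$). A partition is a hook+column partition if it is of the form $(\alpha,2^\beta,1^\gamma)$, where $\alpha$ is the first part (possibly equal to $1$ or $2$), followed by $\beta$ parts equal to $2$ and $\gamma$ parts equal to $1$ (so for example $(1^5)=(1,2^0,1^4)$ and $(2^2,1)=(2,2^1,1^1)$). Flip involution: let $r\ge 2$ be an integer and $\lambda=(\lambda_1,2^\beta,1^\gamma)$ a hook+column partition such that $\lambda_1-r-\gamma=2\delta$ for some non-negative integer $\delta$. Then the flip with offset $r$ is defined on $\lambda=(r+2\delta+\gamma,2^\beta,1^\gamma)$ by $\mathrm{flip}(r;\lambda)=(r+2\beta+\gamma,2^\delta,1^\gamma)$. It is not defined on other partitions. Write $[\mu]f$ for the coefficient of $s_\mu$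 in the Schur expansion of $f$, and $\mathrm{supp}(f)=\{\mu:[\mu]f\neq 0\}$. A symmetric function $f$ is flip-symmetric with offset $r$ (where $r\ge2$) if for every hook+column partition $\mu\in\mathrm{supp}(f)$: (1) $\mathrm{flip}(r;-)$ is defined on $\mu$, and (2) $[\mu]f=[\mathrm{flip}(r;\mu)]f$. *)

(* Defs.v *)
From HB Require Import structures.
From mathcomp Require Import all_boot all_order all_fingroup all_algebra.
From mathcomp Require Import finmap.
From mathcomp Require Export monalg.
From Stdlib Require Import ClassicalEpsilon.

Set Implicit Arguments.
Unset Strict Implicit.
Unset Printing Implicit Defensive.

Import GRing.Theory Num.Theory.

Local Open Scope ring_scope.

(* Lambda = Q[p_1, p_2, ...]: polynomials over Q in countably many variables; *)
(* the variable of index i : nat is p_{i+1}.                                  *)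
Notation Lambda := {malg rat[{cmonom nat}]}.

(* p_k, meaningful for k >= 1 only (psum 0 is a junk value). *)
Definition psum (k : nat) : Lambda := << ucm k.-1 >>.

(* p_{i+1} has degree i+1. *)
Definition pweight (m : {cmonom nat}) : nat :=
  (\sum_(i <- finsupp m) m i * i.+1)%N.

Definition homogeneous (n : nat) (f : Lambda) : Prop :=
  forall m, m \in msupp f -> pweight m = n.

Definition pmonomial (x : nat -> Lambda) (m : {cmonom nat}) : Lambda :=
  \prod_(i <- finsupp m) x i.+1 ^+ m i.

(* The algebra endomorphism of Lambda sending p_k to x k for every k >= 1. *)
Definition psubst (x : nat -> Lambda) (f : Lambda) : Lambda :=
  mmap malgC (pmonomial x) f.

(* p_n o f: each p_m in f is replaced by p_{nm}. *)
Definition padams (n : nat) (f : Lambda) : Lambda :=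
  psubst (fun m => psum (n * m)) f.

(* g o f: each p_n in g is replaced by p_n o f. *)
Definition plethysm (g f : Lambda) : Lambda := psubst (padams^~ f) g.

(* Integer partitions: nonincreasing sequences of positive integers. *)
Definition is_partition (s : seq nat) : bool := sorted geq s && (0%N \notin s).

Record partition := Partition { parts :> seq nat; _ : is_partition parts }.
HB.instance Definition _ := [isSub for parts].
HB.instance Definition _ := [Choice of partition by <:].

(* The complete homogeneous function h_n = sum_{mu |- n} p_mu / z_mu, written *)
(* as the average over s in S_n of p_{cycle type of s}.                       *)
Definition hsym (n : nat) : Lambda :=
  (n`!%:R)^-1 *: \sum_(s : 'S_n) \prod_(c in porbits s) psum #|c|.

(* Jacobi-Trudi: s_lambda = det (h_{lambda_i - i + j}), with h_k = 0 if k < 0. *)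
Definition schur (la : seq nat) : Lambda :=
  \det (\matrix_(i < size la, j < size la)
          (if (i <= nth 0 la i + j)%N then hsym (nth 0 la i + j - i) else 0)).

(* c is the (finitely supported) family of coefficients of f on the s_mu. *)
Definition schur_expansion (f : Lambda) (c : {malg rat[partition]}) : Prop :=
  f = \sum_(mu <- msupp c) c@_mu *: schur mu.

(* [mu]f; as the Schur functions form a basis of Lambda, the expansion of f   *)
(* picked here exists and is unique.                                          *)
Definition schur_coef (mu : partition) (f : Lambda) : rat :=
  (epsilon (inhabits 0) (schur_expansion f))@_mu.

Definition schur_positive (f : Lambda) : Prop :=
  forall mu : partition, schur_coef mu f \is a Num.nat.

(* The sequence (a, 2^b, 1^c). *)
Definition hookcol_seq (a b c : nat) : seq nat := a :: nseq b 2 ++ nseq c 1.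

Definition is_hookcol (la : partition) : Prop :=
  exists a b c, la = hookcol_seq a b c :> seq nat.

(* flip r la mu: flip(r; la) is defined and equal to mu. *)
Definition flip (r : nat) (la mu : partition) : Prop :=
  exists b c d : nat,
    la = hookcol_seq (r + 2 * d + c) b c :> seq nat /\
    mu = hookcol_seq (r + 2 * b + c) d c :> seq nat.

Definition flip_symmetric (r : nat) (f : Lambda) : Prop :=
  forall mu : partition, is_hookcol mu -> schur_coef mu f != 0 ->
  exists2 nu : partition, flip r mu nu & schur_coef mu f = schur_coef nu f.

(* flip r is the graph of a partial function, with domain as expected. *)

Lemma hookcol_seq_inj a b c a' b' c' :
  hookcol_seq a b c = hookcol_seq a' b' c' -> [/\ a = a', b = b' & c = c'].
Proof.
case=> -> e.
have e1 := congr1 (count_mem 1%N) e; have e2 := congr1 (count_mem 2%N) e.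
move: e1 e2; rewrite !count_cat !count_nseq /= !mul0n !mul1n !add0n !addn0.
by move=> -> ->.
Qed.

Lemma flip_fun r la mu nu : flip r la mu -> flip r la nu -> mu = nu.
Proof.
move=> [b [c [d [e1 e2]]]] [b' [c' [d' [e1' e2']]]]; apply: val_inj => /=.
have [ea eb ec] := hookcol_seq_inj (etrans (esym e1) e1').
rewrite e2 e2'; subst b' c'; congr hookcol_seq.
by apply/eqP; rewrite -(eqn_pmul2l (isT : (0 < 2)%N)); move/addIn/addnI: ea => ->.
Qed.

Lemma is_partition_hookcol a b c :
  (2 <= a)%N -> is_partition (hookcol_seq a b c).
Proof.
move=> a2; rewrite /is_partition /hookcol_seq inE !mem_cat !mem_nseq !andbF /=.
rewrite orbF andbC; case: a a2 => //= a a2.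
elim: b a a2 => [|b IH] a a2 /=; last by rewrite IH ?andbT.
by by case: c => //= c; elim: c.
Qed.

Lemma flip_dom r (la : partition) (b c d : nat) : (2 <= r)%N ->
  la = hookcol_seq (r + 2 * d + c) b c :> seq nat -> exists mu, flip r la mu.
Proof.
move=> r2 e.
have H : is_partition (hookcol_seq (r + 2 * b + c) d c).
  by apply: is_partition_hookcol; rewrite -addnA (leq_trans r2) ?leq_addr.
by exists (Partition H), b, c, d.
Qed.

(* The rules that characterize plethysm. *)

Section Psubst.
Variable x : nat -> Lambda.

Local Notation mon := (pmonomial x).

Let monE (m : {cmonom nat}) (d : {fset nat}) : (finsupp m `<=` d)%fset ->
  mon m = \prod_(i <- d) x i.+1 ^+ m i.
Proof.
move=> le; rewrite /pmonomial (big_fset_incl _ le) // => i _.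
by rewrite -cmE_eq0 => /eqP ->; rewrite expr0.
Qed.

Let mon_mmorph : mmorphism mon.
Proof.
split; last by rewrite /pmonomial mdom1 big_seq_fset0.
move=> m1 m2; rewrite (monE (d := (finsupp m1 `|` finsupp m2)%fset)) ?mdomD //.
rewrite (monE (m := m1) (fsubsetUl _ (finsupp m2))).
rewrite (monE (m := m2) (fsubsetUr (finsupp m1) _)).
by rewrite -big_split /=; apply: eq_bigr => i _; rewrite cmM exprD.
Qed.

HB.instance Definition _ := isMultiplicative.Build _ _ mon mon_mmorph.

Lemma psubstD : {morph psubst x : f g / f + g}.
Proof. exact: (mmapD (f := @malgC _ _) (h := mon)). Qed.

Lemma psubstM : {morph psubst x : f g / f * g}.
Proof. exact: (rmorphM (mmap (@malgC _ _) mon)). Qed.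

Lemma psubst1 : psubst x 1 = 1.
Proof. exact: (rmorph1 (mmap (@malgC _ _) mon)). Qed.

Lemma psubstZ a f : psubst x (a *: f) = a *: psubst x f.
Proof.
rewrite -[RHS]mul_malgC.
exact: (mmapZ (f := @malgC {cmonom nat} rat) (h := mon) a f).
Qed.

Lemma psubst_psum k : (0 < k)%N -> psubst x (psum k) = x k.
Proof.
case: k => // k _.
apply: etrans (mmapU (f := @malgC {cmonom nat} rat) (h := mon) 1 (ucm k)) _.
apply: etrans (congr1 ( *%R^~ _) (mpolyC1E _ _)) _.
by rewrite mul1r /pmonomial mdomU big_seq_fset1 cmUU expr1.
Qed.

End Psubst.

Lemma padams_psum n m : (0 < m)%N -> padams n (psum m) = psum (n * m).
Proof. by move=> m0; rewrite /padams psubst_psum. Qed.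

Lemma plethysm_psuml n f : (0 < n)%N -> plethysm (psum n) f = padams n f.
Proof. by move=> n0; rewrite /plethysm psubst_psum. Qed.

Lemma eq_psubst x y f :
  (forall k, (0 < k)%N -> x k = y k) -> psubst x f = psubst y f.
Proof.
move=> exy; rewrite /psubst /mmap; apply: eq_bigr => m _.
suff -> : pmonomial x m = pmonomial y m by [].
by apply: eq_bigr => i _; rewrite exy.
Qed.

Lemma plethysm_psumr n f : (0 < n)%N -> plethysm f (psum n) = padams n f.
Proof.
move=> n0; rewrite /plethysm [RHS]/padams; apply: eq_psubst => k k0.
by rewrite mulnC padams_psum.
Qed.

(* Main.v *)
From HB Require Import structures.
From mathcomp Require Import all_boot all_fingroup all_algebra all_field all_character.
From mathcomp Require Import finmap ring zify.
From Stdlib Require Import ClassicalEpsilon.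
Require Import Defs.

(** Write f in Lambda_n for the given function. In power sums, s_2 o f and
    s_(1,1) o f are (f^2 + p_2 o f) / 2 and (f^2 - p_2 o f) / 2
    (plethysm_two, plethysm_one_one), and the two properties are proved
    independently for these expressions.

    Positivity is a statement about characters. A Schur positive f is the
    Frobenius characteristic of a character of S_n, afforded by a
    representation V (schur_positive_char). The wreath product of S_n with a
    group of order 2 acts on the tensor square of V, where the exchange of the
    two factors may be twisted by a sign, and the characteristic of this
    representation, induced to S_2n, is (f^2 + p_2 o f) / 2 or
    (f^2 - p_2 o f) / 2 (square_plethysm_positive). The characteristic of a
    character has natural coefficients, because these are scalar products with
    characters of the symmetric group (schur_coef_nat). For this, the
    coefficient of s_mu in f is obtained as the coefficient of x^(mu + delta)
    in the product of f with the Vandermonde determinant, in sufficiently many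
    variables (frobenius_schur_coef). Applied to the power sums, it gives
    integral combinations of permutation characters on colourings; they have
    norm 1, so they are irreducible characters up to sign, and the sign is
    positive since s_mu has coefficient 1 in h_mu (frobenius_char_char).

    Flip symmetry is read off an evaluation of Lambda in one even variable x
    and two odd variables y_1, y_2, that is
    p_k |-> x^k - (-1)^k (y_1^k + y_2^k). Put y_1 + y_2 = t u and
    y_1 y_2 = t^2. Then s_mu |-> 0 if mu_2 > 2, and for a >= 2 the partition
    (a, 2^b, 1^c) has the value
    (x^2 + t u x + t^2) x^(a-2) t^(2b+c) U_c(u), with U_c a Chebyshev
    polynomial (super_schur_cons, jtdet_hook). If a = r + 2 d + c, then x^(r-2)
    splits off and leaves x^(2d+c) t^(2b+c); the flip exchanges b and d, hence
    x and t. So f, with no coefficient at the column (1^n), is flip-symmetric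
    with offset r exactly when its evaluation is x^(r-2) (x^2 + t u x + t^2)
    times a function symmetric in x and t (super_flip_symmetric,
    extract_flip). The evaluation of p_2 o f is that of f at x^2, -y_1^2,
    -y_2^2, which means replacing t by -t^2 and u by u^2 - 2, and under this
    substitution x^2 + t u x + t^2 becomes
    (x^2 + t u x + t^2) (x^2 - t u x + t^2). Hence the evaluations of f^2 and of
    p_2 o f are both x^(2r-4) (x^2 + t u x + t^2) times a symmetric function,
    which is the criterion with offset 2 r - 2 (flip_square_plethysm). *)

Set Implicit Arguments.
Unset Strict Implicit.
Unset Printing Implicit Defensive.

Import GRing.Theory Num.Theory.
Local Open Scope ring_scope.

Local Notation "1" := (@mone _) : monom_scope.
Local Notation "x * y" := (mmul x y) : monom_scope.

(** * Newton's identities *)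

Section Newton.
Variable R : comNzRingType.
Implicit Types (P Q a b : nat -> R) (p q : {poly R}).

(** Power sums P 1, P 2, ... and complete functions a 0, a 1, ... of the same
    alphabet, related by n h_n = p_1 h_(n-1) + ... + p_n h_0. In terms of
    generating series, X A' = P A. *)
Definition newton P a :=
  a 0%N = 1 /\ forall n, a n *+ n = \sum_(k < n) P k.+1 * a (n - k.+1)%N.

Definition conv a b n := \sum_(i < n.+1) a i * b (n - i)%N.

Lemma eq_newton P Q a b :
  (forall k, P k.+1 = Q k.+1) -> a =1 b -> newton P a -> newton Q b.
Proof.
move=> eP ea [a0 H]; split=> [|n]; first by rewrite -ea.
by rewrite -ea H; apply: eq_bigr => k _; rewrite eP ea.
Qed.

(* The truncated series satisfy X A' = P A up to degree n. *)
Let newton_poly P a n (A := \poly_(i < n.+1) a i)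
  (Pp := \poly_(k < n.+1) (if k is k'.+1 then P k'.+1 else 0)) :
  newton P a -> forall m, (m <= n)%N -> (Pp * A)`_m = ('X * A^`())`_m.
Proof.
move=> [_ H] m le_mn; rewrite coefM big_ord_recl /= coef_poly /= mul0r add0r.
transitivity (a m *+ m).
  rewrite H; apply: eq_bigr => k _; rewrite !coef_poly /bump /= add1n.
  have lk := ltn_ord k.
  by rewrite !ifT //; lia.
rewrite coefXM; case: m le_mn => [|m] le_mn /=; first by rewrite mulr0n.
by rewrite coef_deriv coef_poly ifT.
Qed.

(** The product rule for derivatives: from X A' = P A and X B' = Q B follows
    X (A B)' = (P + Q) (A B). Joining two alphabets adds the power sums and
    multiplies the generating series. *)
Lemma newton_conv P Q a b :
  newton P a -> newton Q b -> newton (fun k => P k + Q k) (conv a b).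
Proof.
move=> Ha Hb; split=> [|n].
  by rewrite /conv big_ord_recl big_ord0 Ha.1 Hb.1 mulr1 addr0.
pose A := \poly_(i < n.+1) a i; pose B := \poly_(i < n.+1) b i.
pose mkP P := \poly_(k < n.+1) (if k is k'.+1 then P k'.+1 else 0 : R).
have EA := newton_poly (n := n) Ha; have EB := newton_poly (n := n) Hb.
have cAB m : (m <= n)%N -> (A * B)`_m = conv a b m.
  move=> le; rewrite coefM; apply: eq_bigr => i _; have := ltn_ord i => li.
  by rewrite !coef_poly !ifT //; lia.
have -> : conv a b n *+ n = ('X * (A * B)^`())`_n.
  rewrite coefXM; case: n @A @B EA EB @mkP cAB => [|n] A B EA EB mkP cAB /=.
    by rewrite mulr0n.
  by rewrite coef_deriv cAB.
have -> : ('X * (A * B)^`())`_n = ((mkP P + mkP Q) * (A * B))`_n.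
  rewrite derivM mulrDr mulrDl !coefD; congr (_ + _).
    rewrite !mulrA !(coefM _ B); apply: eq_bigr => i _.
    by rewrite EA // -ltnS.
  rewrite mulrCA [mkP Q * _]mulrCA !(coefM A); apply: eq_bigr => i _.
  by rewrite EB // leq_subr.
rewrite coefM big_ord_recl /= coefD !coef_poly /= add0r mul0r add0r.
apply: eq_bigr => k _; rewrite coefD !coef_poly /bump /= add1n.
by have lk := ltn_ord k; rewrite !ifT ?cAB //; lia.
Qed.

Lemma newton_geom (x : R) : newton (fun k => x ^+ k) (fun n => x ^+ n).
Proof.
split=> [|n]; first by rewrite expr0.
rewrite (eq_bigr (fun=> x ^+ n)) ?sumr_const ?card_ord // => k _.
by rewrite -exprD subnKC.
Qed.

(** The formal negative of the alphabet {x}: its power sums are - x^k, and its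
    generating series is the inverse of the geometric one. *)
Lemma newton_lin (x : R) :
  newton (fun k => - x ^+ k) (fun n => (1 - x *: 'X : {poly R})`_n).
Proof.
have cE n : (1 - x *: 'X : {poly R})`_n = (n == 0%N)%:R - x *+ (n == 1%N).
  by rewrite coefB coefZ coefX coef1 mulr_natr.
split=> [|n]; first by rewrite cE /= mulr0n subr0.
rewrite cE; case: n => [|[|n]]; first by rewrite big_ord0.
  by rewrite big_ord_recl big_ord0 /= cE /= mulr0n mulr1n; ring.
rewrite big_ord_recr big_ord_recr /= big1 => [|k _].
  by rewrite !subSS subnn subSnn !cE /= mulr0n mulr1n !exprS; ring.
have lk := ltn_ord k; rewrite cE.
have [-> ->] : (n.+2 - k.+1 == 0)%N = false /\ (n.+2 - k.+1 == 1)%N = false.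
  by split; apply/eqP; lia.
by rewrite mulr0n subr0 mulr0.
Qed.

Lemma newton_one : newton (fun=> 0) (fun n => (n == 0%N)%:R).
Proof.
split=> // -[|n]; first by rewrite big_ord0.
by rewrite mul0rn big1 // => k _; rewrite mul0r.
Qed.

Lemma newton_polyM P Q p q :
  newton P (fun n => p`_n) -> newton Q (fun n => q`_n) ->
  newton (fun k => P k + Q k) (fun n => (p * q)`_n).
Proof.
move=> Hp Hq; apply: eq_newton (newton_conv Hp Hq) => // n.
by rewrite coefM.
Qed.

Variable iota : {rmorphism rat -> R}.

Lemma mulrSn_inj n : injective (fun x : R => x *+ n.+1).
Proof.
have E (y : R) : y = iota (n.+1%:R^-1) * (y *+ n.+1).
  rewrite -[y *+ _]mulr_natl mulrA -(rmorph_nat iota) -rmorphM mulVf ?rmorph1 ?mul1r //.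
  by rewrite pnatr_eq0.
by move=> x y /= exy; rewrite (E x) exy -E.
Qed.

(** The recursion determines n a_n, hence a_n, because the image of the
    rationals makes n invertible. *)
Lemma newton_unique P a b : newton P a -> newton P b -> a =1 b.
Proof.
move=> [a0 Ha] [b0 Hb] n; elim: n {-2}n (leqnn n) => [|n IH] [|m] // le_mn.
- by rewrite a0.
- by rewrite a0.
apply: (@mulrSn_inj m); rewrite /= Ha Hb; apply: eq_bigr => k _.
by rewrite IH //; lia.
Qed.

End Newton.

(** * Sums over the symmetric group weighted by cycle type *)

Lemma imset_setD1 (T T' : finType) (f : T -> T') (A : {set T}) a :
  injective f -> f @: (A :\ a) = f @: A :\ f a.
Proof.
move=> fI; apply/setP => y; rewrite in_setD1; apply/imsetP/andP.
  by case=> x /setD1P[ne xA] ->; rewrite (inj_eq fI) ne imset_f.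
case=> ne /imsetP[x xA e]; exists x => //; rewrite in_setD1 xA andbT.
by apply: contraNneq ne => <-; rewrite e.
Qed.

Section CycleProducts.
Variables (R : comNzRingType) (p : nat -> R).

(** The power sum p_mu for mu the cycle type of s. *)
Definition cycle_prod (T : finType) (s : {perm T}) : R :=
  \prod_(c in porbits s) p #|c|.

Lemma porbit_sub (T : finType) (s : {perm T}) (A : {set T}) x :
  (forall y, y \in A -> s y \in A) -> x \in A -> porbit s x \subset A.
Proof.
move=> clA xA; apply/subsetP => y /porbitP[i ->].
by elim: i => [|i IH]; rewrite ?expg0 ?perm1 // expgSr permM clA.
Qed.

Lemma porbit_step (T : finType) (s : {perm T}) x y :
  y \in porbit s x -> s y \in porbit s x.
Proof. by case/porbitP=> i ->; rewrite -permM -expgSr mem_porbit. Qed.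

Section Image.
Variables (T T' : finType) (f : T -> T') (s : {perm T}) (s' : {perm T'}).
Hypotheses (fI : injective f) (fs : forall x, f (s x) = s' (f x)).

(** An injection that intertwines s and s' carries cycles to cycles. *)
Lemma porbit_image x : porbit s' (f x) = f @: porbit s x.
Proof.
have E i y : (s' ^+ i)%g (f y) = f ((s ^+ i)%g y).
  elim: i y => [|i IH] y; first by rewrite !expg0 !perm1.
  by rewrite !expgS !permM -fs IH.
apply/setP => y; apply/porbitP/imsetP => [[i ->]|[z /porbitP[i ->] ->]].
  by exists ((s ^+ i)%g x); rewrite ?mem_porbit.
by exists i; rewrite E.
Qed.

Lemma imset_porbits : [set f @: c | c : {set T} in porbits s]
  = [set porbit s' y | y in codom f].
Proof.
apply/setP => c; apply/imsetP/imsetP => [[d /imsetP[x _ ->] ->]|[y /codomP[x ->] ->]].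
  by exists (f x); rewrite ?codom_f ?porbit_image.
by exists (porbit s x); rewrite ?porbit_image ?imset_f.
Qed.

Lemma prod_imset_porbits (P : {set {set T}}) :
  \prod_(c in [set f @: c | c : {set T} in P]) p #|c| = \prod_(c in P) p #|c|.
Proof.
rewrite big_imset /=; last by move=> c d _ _; apply: imset_inj.
by apply: eq_bigr => c _; rewrite card_imset.
Qed.

End Image.

Section Merge.
(* Multiplying t by the transposition of a fixed point x with y inserts x in
   the cycle of y and leaves the other cycles unchanged. *)
Variables (T : finType) (t : {perm T}) (x y : T).
Hypotheses (tx : t x = x) (neq_xy : y != x).
Let u := (t * tperm x y)%g.

Let y_fix : x \notin porbit t y.
Proof.
apply/negP; rewrite porbit_sym => /porbitP[i e].
suff ex : (t ^+ i)%g x = x by move: neq_xy; rewrite e ex eqxx.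
by elim: i {e} => [|i IH]; rewrite ?expg0 ?perm1 // expgS permM tx.
Qed.

Let uE z : z != x -> t z != y -> u z = t z.
Proof.
move=> zx ty; rewrite /u permM tpermD //; last by rewrite eq_sym.
by rewrite eq_sym; apply: contra zx => /eqP e; rewrite -(inj_eq (@perm_inj _ t)) tx e.
Qed.

Lemma porbit_merge_fix : porbit u x = x |: porbit t y.
Proof.
have ux : u x = y by rewrite /u permM tx tpermL.
apply/eqP; rewrite eqEsubset; apply/andP; split.
  apply: porbit_sub; last by rewrite setU11.
  move=> z /setU1P[->|zy]; first by rewrite ux setU1r ?porbit_id.
  have [ty|ty] := eqVneq (t z) y.
    by rewrite /u permM ty tpermR setU11.
  rewrite uE ?setU1r ?porbit_step //.
  by apply: contraNneq y_fix => <-.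
apply/subsetP => z /setU1P[->|/porbitP[i ->]]; first exact: porbit_id.
elim: i => [|i IH]; first by rewrite expg0 perm1 -ux porbit_step ?porbit_id.
rewrite expgSr permM; set w := (t ^+ i)%g y in IH *.
have [->|ty] := eqVneq (t w) y; first by rewrite -ux porbit_step ?porbit_id.
rewrite -uE ?porbit_step //.
by apply: contraNneq y_fix => <-; rewrite /w mem_porbit.
Qed.

Lemma porbit_merge_out z : z \notin x |: porbit t y -> porbit u z = porbit t z.
Proof.
rewrite in_setU1 negb_or => /andP[zx zy].
have E i : (t ^+ i)%g z \notin x |: porbit t y.
  elim: i => [|i IH]; first by rewrite expg0 perm1 in_setU1 negb_or zx.
  rewrite expgSr permM; set w := (t ^+ i)%g z in IH *; apply: contra IH.
  case/setU1P => [e|h]; first by rewrite in_setU1 -(inj_eq (@perm_inj _ t)) tx e eqxx.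
  by rewrite setU1r // -eq_porbit_mem -(porbit_perm t 1 w) expg1 eq_porbit_mem.
have Eu i : (u ^+ i)%g z = (t ^+ i)%g z.
  elim: i => [|i IH]; first by rewrite !expg0.
    rewrite !expgSr (permM (u ^+ i)%g) (permM (t ^+ i)%g) IH uE //.
    by apply: contra (E i) => /eqP->; rewrite setU11.
  apply: contra (E i.+1) => /eqP; rewrite expgSr permM => ->.
  by rewrite setU1r ?porbit_id.
by apply/setP => w; apply/porbitP/porbitP => -[i ->]; exists i; rewrite Eu.
Qed.

Lemma porbits_merge :
  porbits u :\ porbit u x = porbits t :\ porbit t y :\ [set x].
Proof.
have px : porbit t x = [set x].
  apply/eqP; rewrite eqEsubset sub1set porbit_id andbT.
  by apply: porbit_sub; rewrite ?set11 // => z /set1P ->; rewrite tx set11.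
have nx z : (porbit t z == [set x]) = (z == x).
  by rewrite -px eq_porbit_mem px in_set1.
apply/setP => c; rewrite !in_setD1.
apply/andP/and3P => [[ne /imsetP[z _ ec]]|[ne1 ne2 /imsetP[z _ ec]]]; subst c.
  have zN : z \notin x |: porbit t y by rewrite -porbit_merge_fix -eq_porbit_mem.
  rewrite porbit_merge_out // nx eq_porbit_mem imset_f //.
  by move: zN; rewrite in_setU1 negb_or => /andP[-> ->].
have zN : z \notin x |: porbit t y.
  by rewrite in_setU1 negb_or -nx ne1 -eq_porbit_mem.
by rewrite -porbit_merge_out // eq_porbit_mem porbit_merge_fix zN imset_f.
Qed.

End Merge.

Section Recursion.
Variable n : nat.
Let M : 'I_n.+1 := ord_max.

(** Every permutation of n+1 points arises once from a permutation s of the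
    first n points by inserting the last point in the cycle of j, or as a new
    cycle when j is the last point itself. *)
Definition insert_max (j : 'I_n.+1) (s : 'S_n) : 'S_n.+1 :=
  (lift_perm M M s * tperm M j)%g.

Lemma insert_max_bij : bijective (fun js : 'I_n.+1 * 'S_n => insert_max js.1 js.2).
Proof.
apply: inj_card_bij => [[j s] [j' s'] /= e|].
  have ej : j = j'.
    have := congr1 (fun v : 'S_n.+1 => v M) e.
    by rewrite /insert_max !permM !lift_perm_id !tpermL.
  subst j'; congr (_, _); move/mulIg: e => e; apply/permP => i.
  have := congr1 (fun v : 'S_n.+1 => v (lift M i)) e.
  by rewrite !lift_perm_lift => /lift_inj.
by rewrite card_prod card_ord !card_Sn factS.
Qed.

(** The cycle product of s in which the cycle of j has weight given by phi
    instead of p. Inserting the last point in the marked cycle shifts phi,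
    which makes the recursion on n possible. *)
Definition marked m (phi : nat -> R) (j : 'I_m) (s : 'S_m) : R :=
  phi #|porbit s j| * \prod_(c in porbits s :\ porbit s j) p #|c|.

Let emb (x : 'I_n) : 'I_n.+1 := lift M x.

Let lI : injective emb.
Proof. exact: lift_inj. Qed.

Let liftM (s : 'S_n) (x : 'I_n) : emb (s x) = lift_perm M M s (emb x).
Proof. by rewrite /emb lift_perm_lift. Qed.

Let porbitsM (s : 'S_n) : porbits (lift_perm M M s) :\ [set M]
  = [set emb @: c | c : {set 'I_n} in porbits s].
Proof.
rewrite (imset_porbits (liftM s)); apply/setP => c.
have pM : porbit (lift_perm M M s) M = [set M].
  apply/eqP; rewrite eqEsubset sub1set porbit_id andbT.
  by apply: porbit_sub; rewrite ?set11 // => z /set1P ->; rewrite lift_perm_id set11.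
rewrite in_setD1 -pM; apply/andP/imsetP => [[ne /imsetP[y _ ey]]|[y /codomP[x ->] ->]].
  exists y => //; case: (unliftP M y) => [x ->|yM]; first exact: codom_f.
  by rewrite ey yM eqxx in ne.
by rewrite imset_f // eq_porbit_mem pM in_set1 eq_sym neq_lift.
Qed.

Lemma marked_insert_fix phi s : marked phi M (insert_max M s) = phi 1%N * cycle_prod s.
Proof.
rewrite /marked /insert_max tperm1 mulg1.
have -> : porbit (lift_perm M M s) M = [set M].
  apply/eqP; rewrite eqEsubset sub1set porbit_id andbT.
  by apply: porbit_sub; rewrite ?set11 // => z /set1P ->; rewrite lift_perm_id set11.
by rewrite cards1 porbitsM prod_imset_porbits //; apply: lI.
Qed.

Lemma marked_insert_lift phi j s :
  marked phi M (insert_max (lift M j) s) = marked (fun k => phi k.+1) j s.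
Proof.
rewrite /marked /insert_max.
have tM : lift_perm M M s M = M by rewrite lift_perm_id.
have neq : lift M j != M by rewrite eq_sym neq_lift.
rewrite porbits_merge // porbit_merge_fix //.
rewrite -/(emb j) (porbit_image (liftM s)) setDDl [in porbits _ :\: _]setUC -setDDl porbitsM.
rewrite cardsU1 card_imset; last exact: lI.
have -> /= : M \notin emb @: porbit s j.
  by apply/imsetP => -[x _ /eqP]; rewrite (negbTE (neq_lift _ _)).
rewrite add1n; congr (_ * _).
rewrite -(prod_imset_porbits lI) imset_setD1 //.
by apply: imset_inj; apply: lI.
Qed.

End Recursion.

(** Conjugation by the transposition of i and j carries the cycle of j to the
    cycle of i. *)
Lemma sum_marked n phi (i j : 'I_n) :
  \sum_(s : 'S_n) marked phi i s = \sum_(s : 'S_n) marked phi j s.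
Proof.
rewrite (reindex_inj (conjg_inj (tperm i j))) /=; apply: eq_bigr => s _.
have cj x : tperm i j (s x) = (s ^ tperm i j)%g (tperm i j x) by rewrite permJ.
have e : porbit (s ^ tperm i j)%g i = tperm i j @: porbit s j.
  by rewrite -(porbit_image cj) tpermR.
have cI : injective (fun c : {set 'I_n} => tperm i j @: c).
  by apply: imset_inj; apply: perm_inj.
rewrite /marked e card_imset; last exact: perm_inj.
congr (_ * _); rewrite -[RHS](prod_imset_porbits (@perm_inj _ (tperm i j))).
rewrite (imset_setD1 _ _ cI) (imset_porbits cj); apply: eq_bigl => c.
rewrite !in_setD1; congr (_ && _); apply/imsetP/imsetP => -[y _ ->]; exists y => //.
by rewrite -(permKV (tperm i j) y) codom_f.
Qed.

Definition cycle_sum n : R := \sum_(s : 'S_n) cycle_prod s.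

Definition marked_sum n phi : R := \sum_(s : 'S_n.+1) marked phi ord_max s.

Lemma sum_marked_max n phi : 
  marked_sum n phi = phi 1%N * cycle_sum n + \sum_(j < n) \sum_(s : 'S_n) marked (fun k => phi k.+1) j s.
Proof.
rewrite /marked_sum (reindex _ (onW_bij _ (insert_max_bij n))) /=.
rewrite -(pair_bigA _ (fun j s => marked phi ord_max (insert_max j s))) /=.
rewrite big_ord_recr /= addrC; congr (_ + _).
  by rewrite mulr_sumr; apply: eq_bigr => s _; rewrite marked_insert_fix.
apply: eq_bigr => j _; apply: eq_bigr => s _.
by rewrite -marked_insert_lift; congr (marked _ _ (insert_max _ _)); apply: ord_inj; rewrite lift_max.
Qed.

(** Either the last point is a cycle by itself, or it is removed from a cycle
    marked at one of the n other points; iterating over the length k+1 of the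
    cycle of the last point gives n (n-1) ... (n-k+1) choices for that cycle. *)
Lemma marked_sumE n phi :
  marked_sum n phi = \sum_(k < n.+1) (phi k.+1 * cycle_sum (n - k)) *+ n ^_ k.
Proof.
elim: n phi => [|n IH] phi.
  by rewrite sum_marked_max big_ord0 addr0 big_ord_recl big_ord0 addr0.
rewrite sum_marked_max [RHS]big_ord_recl /= subn0 mulr1n; congr (_ + _).
rewrite (eq_bigr (fun=> marked_sum n (fun k => phi k.+1))) => [|j _]; last exact: sum_marked.
rewrite sumr_const card_ord IH -sumrMnl; apply: eq_bigr => k _.
by rewrite -mulrnA /bump /= add1n subSS ffactSS mulnC.
Qed.

Lemma cycle_sumE n :
  cycle_sum n.+1 = \sum_(k < n.+1) (p k.+1 * cycle_sum (n - k)) *+ n ^_ k.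
Proof.
rewrite -marked_sumE; apply: eq_bigr => s _; rewrite /marked /cycle_prod.
by rewrite (big_setD1 (porbit s ord_max)) // imset_f.
Qed.

End CycleProducts.

Lemma hsymE n : hsym n = (n`!%:R)^-1 *: cycle_sum psum n.
Proof. by rewrite /hsym /cycle_sum /cycle_prod. Qed.

(** The cycle that contains the last point, of length k+1, contributes
    p_(k+1), and the rest of the permutation contributes h_(n-k-1). *)
Lemma hsym_newton : newton psum hsym.
Proof.
split=> [|n].
  rewrite hsymE /cycle_sum (eq_bigr (fun=> 1)) => [|s _].
    by rewrite sumr_const card_Sn /= fact0 invr1 scale1r.
  rewrite /cycle_prod big_pred0 // => c.
  by apply/negbTE/imsetP => -[[]].
case: n => [|n]; first by rewrite big_ord0.
have f0 m : (m`!%:R : rat) != 0 by rewrite pnatr_eq0 -lt0n fact_gt0.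
rewrite hsymE cycle_sumE -scaler_nat scalerA.
have -> : n.+1%:R * (n.+1`!%:R)^-1 = (n`!%:R)^-1 :> rat.
  by rewrite factS natrM invfM mulrA mulfV ?mul1r ?pnatr_eq0.
rewrite scaler_sumr; apply: eq_bigr => k _.
rewrite subSS hsymE -scalerAr -[X in _ *: X]scaler_nat scalerA.
have lk : (k <= n)%N by rewrite -ltnS.
suff -> : (n`!%:R)^-1 * (n ^_ k)%:R = ((n - k)`!%:R)^-1 :> rat by [].
rewrite -(ffact_fact lk) natrM invfM mulrAC mulVf ?mul1r //.
by rewrite pnatr_eq0 -lt0n ffact_gt0.
Qed.

(** * Evaluation homomorphisms of Lambda *)

Lemma cmonom_ind (I : choiceType) (P : {cmonom I} -> Prop) :
  P 1%M -> (forall i m, P m -> P (ucm i * m)%M) -> forall m, P m.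
Proof.
move=> P1 PM m; have [n] := ubnP (mdeg m); elim: n m => // n IH m.
have [->//|/eqP ne] := eqVneq m 1%M; rewrite ltnS => le_mn.
have [i im] : exists i, i \in finsupp m.
  have [e|[i im]] := fset_0Vmem (finsupp m); last by exists i.
  by case: ne; apply/eqP/cmP => i; rewrite cm1; apply/eqP; rewrite cmE_eq0 e.
have -> : m = (ucm i * divcm m (ucm i))%M.
  apply/eqP/cmP => j; rewrite cmM divcmE cmU subnKC //.
  by case: eqVneq => // <-; rewrite lt0n cmE_neq0.
apply: PM; apply: IH; apply: leq_trans le_mn.
have {2}-> : m = (ucm i * divcm m (ucm i))%M.
  apply/eqP/cmP => j; rewrite cmM divcmE cmU subnKC //.
  by case: eqVneq => // <-; rewrite lt0n cmE_neq0.
by rewrite mdegM mdegU.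
Qed.

Lemma malgUM (K : monomType) (R : nzRingType) (k l : K) :
  << (k * l)%M >> = << k >> * << l >> :> {malg R[K]}.
Proof. by rewrite malgM_def fgmulUU mulr1. Qed.

Lemma malgU_scale (K : choiceType) (R : nzRingType) (c : R) (k : K) :
  << c *g k >> = c *: << k >> :> {malg R[K]}.
Proof. by apply/malgP => l; rewrite mcoeffZ !mcoeffU mulr_natr. Qed.

Lemma malg_ind (K : choiceType) (R : nzRingType) (P : {malg R[K]} -> Prop) :
  P 0 -> (forall f g, P f -> P g -> P (f + g)) ->
  (forall c k, P << k >> -> P (c *: << k >>)) -> (forall k, P << k >>) -> forall f, P f.
Proof.
move=> P0 PD PZ PU f; rewrite (monalgE f); elim/big_ind: _ => // k _.
by rewrite malgU_scale; apply: PZ.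
Qed.

Lemma Lambda_ind (P : Lambda -> Prop) :
  (forall f g, P f -> P g -> P (f + g)) -> (forall c f, P f -> P (c *: f)) ->
  P 1 -> (forall k f, P f -> P (psum k.+1 * f)) -> forall f, P f.
Proof.
move=> PD PZ P1 PM; apply: malg_ind.
- by rewrite -(scale0r 1); exact: PZ P1.
- exact: PD.
- by move=> c k Pk; exact: PZ Pk.
apply: cmonom_ind; first exact: P1.
by move=> i m Pm; rewrite malgUM; exact: PM Pm.
Qed.

Lemma rat_rmorph_unique (R : comNzRingType) (f g : {rmorphism rat -> R}) : f =1 g.
Proof.
have H (h : {rmorphism rat -> R}) c : h (denq c)%:~R * h c = (numq c)%:~R.
  by rewrite -(rmorph_int h) -rmorphM mulrC -numqE rmorph_int.
move=> c; have dc : ((denq c)%:~R : rat) \is a GRing.unit.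
  by rewrite unitfE intr_eq0 denq_neq0.
have : f (denq c)%:~R * f c = f (denq c)%:~R * g c.
  by rewrite (H f) (rmorph_int f) -(rmorph_int g (denq c)) (H g).
move/(congr1 ( *%R (f (denq c)%:~R^-1))).
by rewrite !mulrA -(rmorphM f) (mulVr dc) (rmorph1 f) !mul1r.
Qed.

(** A ring homomorphism out of Lambda is determined by the images of the
    power sums, as all homomorphisms from the rationals agree. *)
Lemma Lambda_rmorph_eq (R : comNzRingType) (f g : {rmorphism Lambda -> R}) :
  (forall k, f (psum k.+1) = g (psum k.+1)) -> f =1 g.
Proof.
move=> e; apply: Lambda_ind => [u v|c u|| k u]; rewrite ?rmorph1 ?rmorphD ?rmorphM //.
- by move=> -> ->.
- by rewrite -mul_malgC !rmorphM /= => ->; congr (_ * _); apply: (rat_rmorph_unique (f \o malgC) (g \o malgC)).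
by rewrite e => ->.
Qed.

Arguments Lambda_rmorph_eq [R] f g _ _.

Section Evaluation.
Variables (R : comNzRingType) (iota : {rmorphism rat -> R}) (x : nat -> R).

Definition eval_monom (m : {cmonom nat}) : R := \prod_(i <- finsupp m) x i.+1 ^+ m i.

Let eval_monomE (m : {cmonom nat}) (d : {fset nat}) : (finsupp m `<=` d)%fset ->
  eval_monom m = \prod_(i <- d) x i.+1 ^+ m i.
Proof.
move=> le; rewrite /eval_monom (big_fset_incl _ le) // => i _.
by rewrite -cmE_eq0 => /eqP ->; rewrite expr0.
Qed.

Let eval_monom_mmorph : mmorphism eval_monom.
Proof.
split; last by rewrite /eval_monom mdom1 big_seq_fset0.
move=> m1 m2; rewrite (eval_monomE (d := (finsupp m1 `|` finsupp m2)%fset)) ?mdomD //.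
rewrite (eval_monomE (m := m1) (fsubsetUl _ (finsupp m2))).
rewrite (eval_monomE (m := m2) (fsubsetUr (finsupp m1) _)).
by rewrite -big_split /=; apply: eq_bigr => i _; rewrite cmM exprD.
Qed.

HB.instance Definition _ := isMultiplicative.Build _ _ eval_monom eval_monom_mmorph.

(** Lambda is free on the power sums, and iota makes R an algebra over the
    rationals, so that the values x k may be chosen at will. *)
Definition eval (f : Lambda) : R := mmap iota eval_monom f.

HB.instance Definition _ := GRing.RMorphism.copy eval (mmap iota eval_monom).

Lemma eval_psum k : (0 < k)%N -> eval (psum k) = x k.
Proof.
case: k => // k _.
apply: etrans (mmapU (f := iota) (h := eval_monom) 1 (ucm k)) _.
apply: etrans (congr1 ( *%R^~ _) (rmorph1 iota)) _.
by rewrite mul1r /eval_monom mdomU big_seq_fset1 cmUU expr1.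
Qed.

Lemma evalZ c f : eval (c *: f) = iota c * eval f.
Proof. exact: (mmapZ (f := iota) (h := eval_monom)). Qed.

(** A homomorphism preserves the Newton identities; with the uniqueness of
    their solution, this computes the images of the complete functions. *)
Lemma eval_hsym_newton : newton x (eval \o hsym).
Proof.
have [h0 hS] := hsym_newton; split=> [|n] /=; first by rewrite h0 rmorph1.
rewrite -rmorphMn hS rmorph_sum; apply: eq_bigr => k _.
by rewrite rmorphM /= eval_psum.
Qed.

Lemma eval_hsym a : newton x a -> forall n, eval (hsym n) = a n.
Proof. move=> Ha; exact: (newton_unique iota eval_hsym_newton Ha). Qed.

Lemma eval_cycle_prod (T : finType) (s : {perm T}) :
  eval (cycle_prod psum s) = cycle_prod x s.
Proof.
rewrite rmorph_prod /=; apply: eq_bigr => c /imsetP[y _ ->].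
by rewrite eval_psum // lt0n card_porbit_neq0.
Qed.

End Evaluation.

Lemma eval_ext (R : comNzRingType) (iota : {rmorphism rat -> R}) (x y : nat -> R) f :
  (forall k, x k.+1 = y k.+1) -> eval iota x f = eval iota y f.
Proof. by move=> e; apply: (Lambda_rmorph_eq (eval iota x) (eval iota y)) => k /=; rewrite !eval_psum. Qed.

Lemma psubst_eval (x : nat -> Lambda) f :
  psubst x f = eval (@malgC {cmonom nat} rat) x f.
Proof. by []. Qed.

Lemma eval_rmorph (R S : comNzRingType) (iota : {rmorphism rat -> R}) (jota : {rmorphism rat -> S}) 
   (g : {rmorphism R -> S}) (x : nat -> R) f :
  g (eval iota x f) = eval jota (g \o x) f.
Proof. by apply: (Lambda_rmorph_eq (g \o eval iota x) (eval jota (g \o x))) => k /=; rewrite !eval_psum. Qed.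

Lemma eval_padams (R : comNzRingType) (iota : {rmorphism rat -> R}) (x : nat -> R) n f :
  (0 < n)%N -> eval iota x (padams n f) = eval iota (fun k => x (n * k)%N) f.
Proof.
move=> n0; rewrite /padams psubst_eval (eval_rmorph _ iota (eval iota x)).
by apply: eval_ext => k /=; rewrite eval_psum // muln_gt0 n0.
Qed.

Lemma psubst_psum_id f : psubst psum f = f.
Proof.
rewrite psubst_eval; apply: (Lambda_rmorph_eq (eval (@malgC {cmonom nat} rat) psum) idfun).
by move=> k /=; rewrite eval_psum.
Qed.

(** * Polynomials in N variables and the bialternant formula *)

Section Variables.
Variables (R : comNzRingType) (N : nat).
Notation PN := {malg R[{cmonom 'I_N}]}.
Implicit Types (v w : 'I_N -> nat) (g : PN).

Definition expo v : {cmonom 'I_N} := [cmonom v i | i in [fset j | j : 'I_N]%fset]%M.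

Lemma expoE v i : expo v i = v i.
Proof. by rewrite cmE fsfun_fun in_fsetE. Qed.

Lemma expoK (m : {cmonom 'I_N}) : expo m = m.
Proof. by apply/eqP/cmP => i; rewrite expoE. Qed.

Lemma eq_expo v w : v =1 w -> expo v = expo w.
Proof. by move=> e; apply/eqP/cmP => i; rewrite !expoE. Qed.

Lemma expo_inj v w : expo v = expo w -> v =1 w.
Proof. by move=> e i; rewrite -(expoE v) e expoE. Qed.

Lemma mdeg_expo v : mdeg (expo v) = (\sum_i v i)%N.
Proof.
suff H (m : {cmonom 'I_N}) : mdeg m = (\sum_i m i)%N.
  by rewrite H; apply: eq_bigr => i _; rewrite expoE.
elim/cmonom_ind: m => [|i m IH].
  by rewrite mdeg1 big1 // => i _; rewrite cm1.
rewrite mdegM IH mdegU [RHS](eq_bigr (fun j => (i == j) + m j)%N) => [|j _]; last by rewrite cmM cmU.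
by rewrite big_split /=; congr addn; rewrite (bigD1 i) //= eqxx big1 // => j /negbTE; rewrite eq_sym => ->.
Qed.

Definition mono v : PN := << expo v >>.

Lemma mono_add v w : mono v * mono w = mono (fun i => v i + w i)%N.
Proof.
rewrite -malgUM; congr << _ >>.
by apply/eqP/cmP => i; rewrite cmM !expoE.
Qed.

Lemma mono0 : mono (fun=> 0%N) = 1.
Proof.
by congr << _ >>; apply/eqP/cmP => i; rewrite expoE cm1.
Qed.

Definition var (i : 'I_N) : PN := << ucm i >>.

Lemma var_mono i : var i = mono (fun j => (i == j)%N).
Proof. by congr << _ >>; apply/eqP/cmP => j; rewrite expoE cmU. Qed.

Lemma varX i k : var i ^+ k = mono (fun j => (i == j) * k)%N.
Proof.
elim: k => [|k IH]; first by rewrite expr0 -mono0; congr << _ >>; apply: eq_expo => j; rewrite muln0.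
by rewrite exprS IH var_mono mono_add; congr << _ >>; apply: eq_expo => j; rewrite mulnS.
Qed.

Lemma mono_sum (I : Type) (r : seq I) (F : I -> 'I_N -> nat) :
  \prod_(t <- r) mono (F t) = mono (fun i => \sum_(t <- r) F t i)%N.
Proof.
elim: r => [|t r IH].
  by rewrite big_nil -mono0; congr << _ >>; apply: eq_expo => i; rewrite big_nil.
by rewrite big_cons IH mono_add; congr << _ >>; apply: eq_expo => i; rewrite big_cons.
Qed.

Lemma prod_varX (s : 'S_N) v : \prod_i var (s i) ^+ v i = mono (fun j => v ((s^-1)%g j)).
Proof.
rewrite (eq_bigr (fun i => mono (fun j => (s i == j) * v i)%N)) => [|i _]; last exact: varX.
rewrite mono_sum; congr << _ >>; apply: eq_expo => j.
rewrite (bigD1 ((s^-1)%g j)) //= permKV eqxx mul1n big1 ?addn0 // => i ne.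
by case: eqP => // e; rewrite -e permK eqxx in ne.
Qed.

Lemma coef_mono v w : (mono v)@_(expo w) = [forall i, v i == w i]%:R.
Proof.
rewrite mcoeffU1; congr (_%:R); congr nat_of_bool.
apply/eqP/forallP => [/expo_inj e i|e]; first by rewrite e.
by apply: eq_expo => i; apply/eqP.
Qed.

Lemma coef_monoM v w g : (mono v * g)@_(expo w) =
  if [forall i, v i <= w i]%N then g@_(expo (fun i => w i - v i)%N) else 0.
Proof.
elim/malg_ind: g => [|f g Hf Hg|c k H|k].
- by rewrite mulr0 !mcoeff0 if_same.
- have -> : mono v * (f + g) = mono v * f + mono v * g by exact: mulrDr.
  rewrite mcoeffD; apply: etrans (congr2 +%R Hf Hg) _; case: ifP => _; last by rewrite addr0.
  by rewrite mcoeffD.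
- have -> : mono v * (c *: << k >>) = c *: (mono v * << k >>) by exact: esym (scalerAr _ _ _).
  rewrite mcoeffZ; apply: etrans (congr1 ( *%R c) H) _; case: ifP => _; last by rewrite mulr0.
  by rewrite mcoeffZ.
have -> : << k >> = mono k by rewrite /mono expoK.
rewrite mono_add !coef_mono; case: ifP => [/forallP le|/forallP le].
  congr (_%:R); congr nat_of_bool; apply/eq_forallb => i.
  by rewrite -{1}(subnKC (le i)) eqn_add2l.
case: forallP => // e; case: le => i.
by rewrite -(eqP (e i)) leq_addr.
Qed.

Lemma coef_CM c g m : (c%:MP * g)@_m = c * g@_m.
Proof. exact: mcoeffCM. Qed.

Definition alternant v : PN := \det (\matrix_(i, j) var j ^+ v i).

Lemma alternantE v : alternant v = \sum_(s : 'S_N) (-1) ^+ s * mono (fun i => v (s i)).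
Proof.
rewrite [LHS](reindex_inj invg_inj) /=; apply: eq_bigr => s _.
rewrite odd_permV; congr (_ * _); rewrite -[s in RHS]invgK -prod_varX.
by apply: eq_bigr => i _; rewrite mxE.
Qed.

Definition staircase (i : 'I_N) : nat := (N.-1 - i)%N.

Lemma coef_signM (b : bool) g m : ((-1) ^+ b * g : PN)@_m = (-1) ^+ b * g@_m.
Proof. by case: b; rewrite ?expr1 ?expr0 ?mulN1r ?mul1r ?mcoeffN. Qed.

Variable iota : {rmorphism rat -> R}.

Definition psum_eval : Lambda -> PN := 
  eval (@malgC {cmonom 'I_N} R \o iota) (fun k => \sum_i var i ^+ k).

HB.instance Definition _ := GRing.RMorphism.copy psum_eval 
  (eval (@malgC {cmonom 'I_N} R \o iota) (fun k => \sum_i var i ^+ k)).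

(** The size N of the determinant is fixed by the number of variables; a
    partition with fewer parts is padded by zeros. *)
Definition jacobi_trudi (h : nat -> Lambda) (nu : nat -> nat) : Lambda :=
  \det (\matrix_(i < N, j < N) (if (i <= nu i + j)%N then h (nu i + j - i)%N else 0)).

Let H n := psum_eval (hsym n).

Let H_newton : newton (fun k => \sum_i var i ^+ k) H.
Proof. exact: eval_hsym_newton. Qed.

(* The generating series of the elementary functions, up to sign, of all
   variables but var j. Its product with the series of the complete functions
   is the geometric series of var j, as CH below states. *)
Let C (j : 'I_N) : {poly PN} := \prod_(i | i != j) (1 - var i *: 'X).

Let C_newton j : newton (fun k => - \sum_(i | i != j) var i ^+ k) (fun n => (C j)`_n).
Proof.
suff HP (P : pred 'I_N) (r : seq 'I_N) : newton (fun k => - \sum_(i <- r | P i) var i ^+ k)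
   (fun n => (\prod_(i <- r | P i) (1 - var i *: 'X) : {poly PN})`_n) by exact: HP.
elim: r => [|i r IH].
  apply: eq_newton (newton_one _) => [k|n]; first by rewrite big_nil oppr0.
  by rewrite big_nil coef1.
case Pi: (P i); last first.
  by apply: eq_newton IH => [k|n]; rewrite big_cons Pi.
apply: eq_newton (newton_polyM (newton_lin (var i)) IH) => [k|n]; rewrite big_cons Pi //.
by rewrite opprD.
Qed.

Let C_size j n : (N <= n)%N -> (C j)`_n = 0.
Proof.
move=> le; apply: nth_default; apply: leq_trans le.
have H2 i : (size (1 - var i *: 'X : {poly PN})%R <= 2)%N.
  rewrite (leq_trans (size_polyD _ _)) // size_polyN geq_max size_poly1 /=.
  by rewrite (leq_trans (size_scale_leq _ _)) // size_polyX.
apply: leq_trans (size_prod_leq _ _) _.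
rewrite leq_subLR; have : (\sum_(i | i != j) size (1 - var i *: 'X : {poly PN})%R <= \sum_(i | i != j) 2)%N.
  by apply: leq_sum => i _.
rewrite sum_nat_const; have : #|[pred i | i != j]| = N.-1.
  by rewrite cardC1 card_ord.
have := ltn_ord j; rewrite -[#|_|]/#|[pred i | i != j]|; lia.
Qed.

Let CH j n : conv (fun n => (C j)`_n) H n = var j ^+ n.
Proof.
apply: (newton_unique (@malgC {cmonom 'I_N} R \o iota)) (newton_geom (var j)) n.
apply: eq_newton (newton_conv (C_newton j) H_newton) => // k.
by rewrite [X in _ + X](bigD1 j) //= addrCA addNr addr0.
Qed.

(** Bialternant formula. Multiplying the matrix of the complete functions
    h_(nu_i - i + k) by the matrix of the signed elementary functions in the
    other variables leaves the matrix of the powers x_j^(nu_i + N - 1 - i).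
    The case nu = 0, where the first matrix is unitriangular, identifies the
    determinant of the second one with the Vandermonde determinant. *)
Lemma psum_eval_jacobi_trudi nu :
  alternant staircase * psum_eval (jacobi_trudi hsym nu)
  = alternant (fun i => nu i + staircase i)%N.
Proof.
pose M nu := (\matrix_(i < N, j < N) (if (i <= nu i + j)%N then H (nu i + j - i)%N else 0)).
pose E := \matrix_(k < N, j < N) (C j)`_(N.-1 - k).
have ME f : M f *m E = \matrix_(i, j) var j ^+ (f i + staircase i).
  apply/matrixP => i j; rewrite !mxE -CH.
  set a := (f i + staircase i)%N; pose F l := (C j)`_l * H (a - l)%N.
  have -> : conv (fun n => (C j)`_n) H a = \sum_(0 <= l < a.+1) F l.
    by rewrite big_mkord.
  transitivity (\sum_(0 <= l < N | (l <= a)%N) F l).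
    rewrite [RHS]big_mkord [RHS]big_mkcond [RHS](reindex_inj rev_ord_inj).
    apply: eq_bigr => l _; rewrite !mxE.
    have li := ltn_ord i; have ll := ltn_ord l.
    have er : rev_ord l = (N.-1 - l)%N :> nat by rewrite /=; lia.
    have -> : (i <= f i + l)%N = (rev_ord l <= a)%N by rewrite er /a /staircase; lia.
    case: ifP => le; last by rewrite mul0r.
    have -> : (f i + l - i = a - rev_ord l)%N by move: le; rewrite er /a /staircase; lia.
    rewrite -er.
    exact: mulrC.
  have [le|lt] := leqP a.+1 N.
    by rewrite (big_nat_widen _ _ _ _ _ le); apply: eq_bigl => l; rewrite ltnS.
  rewrite [RHS](big_cat_nat (n := N)) ?(ltnW lt) //= [X in _ = _ + X]big_nat.
  rewrite [X in _ = _ + X]big1 ?addr0 => [|l /andP[/C_size e _]]; last by rewrite /F e mul0r.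
  rewrite big_nat_cond [RHS]big_nat_cond; apply: eq_bigl => l.
  by rewrite andbT; apply/andP/idP => [[]//|lN]; split => //; lia.
have detM f : psum_eval (jacobi_trudi hsym f) = \det (M f).
  rewrite -det_map_mx; congr (\det _); apply/matrixP => i j; do 3![rewrite mxE].
  by case: ifP => // _; rewrite rmorph0.
have dM0 : \det (M (fun=> 0%N)) = 1.
  rewrite -det_tr det_trig; last first.
    apply/is_trig_mxP => i j lij; rewrite !mxE add0n ifF //.
    by rewrite leqNgt lij.
  by rewrite big1 // => i _; rewrite !mxE add0n leqnn subnn H_newton.1.
have dE : \det E = alternant staircase.
  by rewrite -[LHS]mul1r -dM0 -det_mulmx ME.
apply: etrans (congr2 *%R (esym dE) (detM nu)) _; apply: etrans (mulrC _ _) _.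
have -> : \det (M nu) * \det E = \det (M nu *m E) by rewrite det_mulmx.
exact: (congr1 (fun A => \det A) (ME nu)).
Qed.

End Variables.

(** * Colourings fixed by a permutation *)

Section Colorings.
Variables (R : comNzRingType) (N : nat) (T : finType).
Implicit Types (phi : {ffun T -> 'I_N}) (s : {perm T}) (v : 'I_N -> nat).

Definition invariant_coloring s phi := [forall t, phi (s t) == phi t].
Definition content phi (i : 'I_N) : nat := (\sum_t (phi t == i))%N.
Definition colorings v : {set {ffun T -> 'I_N}} :=
  [set phi | [forall i, content phi i == v i]].

Lemma invariant_porbit s phi t u :
  invariant_coloring s phi -> u \in porbit s t -> phi u = phi t.
Proof.
move=> /forallP inv /porbitP[i ->]; elim: i => [|i IH]; first by rewrite perm1.
by rewrite expgSr permM (eqP (inv _)).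
Qed.

Lemma mono_content phi : mono R (content phi) = \prod_t var R (phi t).
Proof.
rewrite (eq_bigr (fun t => mono R (fun i => phi t == i : nat))) => [|t _]; last exact: var_mono.
by rewrite mono_sum.
Qed.

(** Expanding the product over the cycles of sum_i x_i^|c| amounts to choosing
    a colour for each cycle, that is, a colouring constant on cycles. The maps
    h and h' go from choices to colourings and back. *)
Lemma cycle_prod_colorings (i0 : 'I_N) s :
  cycle_prod (fun k => \sum_i var R i ^+ k) s
  = \sum_(phi | invariant_coloring s phi) mono R (content phi).
Proof.
rewrite /cycle_prod (big_distr_big i0).
pose h (f : {ffun {set T} -> 'I_N}) := [ffun t => f (porbit s t)] : {ffun T -> 'I_N}.
pose h' (phi : {ffun T -> 'I_N}) : {ffun {set T} -> 'I_N} :=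
  [ffun c : {set T} => if [pick t in c | c \in porbits s] is Some t then phi t else i0].
have hK phi : invariant_coloring s phi -> h (h' phi) = phi.
  move=> inv; apply/ffunP => t; rewrite !ffunE.
  case: pickP => [u /andP[ut _]|/(_ t)]; first exact: invariant_porbit ut.
  by rewrite porbit_id imset_f.
rewrite [RHS](reindex_onto h h' hK); apply: eq_big => [f|f _].
  apply/pfamilyP/andP => [[/subsetP fs _]|[_ /eqP e]].
    split.
      apply/forallP => t; rewrite !ffunE.
      by have -> : porbit s (s t) = porbit s t by exact: (porbit_perm s 1 t).
    apply/eqP/ffunP => c; rewrite ffunE; case: pickP => [u /andP[uc /imsetP[t _ ec]]|none].
      rewrite ffunE ec; congr (f _); apply/eqP; rewrite eq_porbit_mem.
      by rewrite -ec.
    apply/esym/eqP; apply: contraT => fc; have /imsetP[t _ ec] := fs c fc.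
    have := none t; rewrite {1}ec porbit_id /= => /negP[]; apply/imsetP.
    by exists t.
  split=> //; apply/subsetP => c; apply: contraR => cN.
  by rewrite -e ffunE; case: pickP => [u /andP[_ cs]|//]; rewrite cs in cN.
rewrite mono_content (partition_big (porbit s) (mem (porbits s))) /= => [|t _]; last exact: imset_f.
apply: eq_bigr => c /imsetP[t _ ->].
rewrite (eq_bigr (fun=> var R (f (porbit s t)))) => [|u /eqP e]; last by rewrite ffunE e.
rewrite prodr_const; congr (_ ^+ _); apply: eq_card => u.
by rewrite -(eq_porbit_mem s u t).
Qed.

Definition fixed_colorings v s :=
  #|[pred phi | invariant_coloring s phi & phi \in colorings v]|.

Lemma coef_cycle_prod (i0 : 'I_N) v s :
  (cycle_prod (fun k => \sum_i var R i ^+ k) s)@_(expo v) = (fixed_colorings v s)%:R.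
Proof.
rewrite (cycle_prod_colorings i0) raddf_sum /=.
rewrite (eq_bigr (fun phi => if phi \in colorings v then 1 else 0)) => [|phi _]; last first.
  by rewrite coef_mono inE; case: ifP.
by rewrite -big_mkcondr sumr_const.
Qed.

Lemma card_content phi : (\sum_i content phi i)%N = #|T|.
Proof.
rewrite exchange_big /= -sum1_card; apply: eq_bigr => t _.
by rewrite (bigD1 (phi t)) //= eqxx big1 // => i /negbTE; rewrite eq_sym => ->.
Qed.

Lemma fixed_colorings0 v s : (\sum_i v i != #|T|)%N -> fixed_colorings v s = 0%N.
Proof.
move=> ne; apply: eq_card0 => phi; rewrite !inE; apply/negbTE/negP => /andP[_ /forallP e].
case/negP: ne; rewrite -(card_content phi); apply/eqP; apply: eq_bigr => i _.
by rewrite (eqP (e i)).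
Qed.

End Colorings.

Section Kernel.
Variable N : nat.
Notation PL := {malg Lambda[{cmonom 'I_N}]}.

(* Polynomials in N variables over Lambda: p_k |-> p_k x_k, where x_k is the
   power sum of the variables, gives the Cauchy kernel. *)
Let iota : {rmorphism rat -> PL} := @malgC {cmonom 'I_N} Lambda \o @malgC {cmonom nat} rat.
Let x k : PL := \sum_(i < N) var _ i ^+ k.
(* The part of the kernel that involves only var i. *)
Let a (i : 'I_N) n : PL := (hsym n)%:MP * var _ i ^+ n.

Let a_newton i : newton (fun k => (psum k)%:MP * var _ i ^+ k) (a i).
Proof.
have [h0 hS] := hsym_newton; split=> [|n].
  by rewrite /a h0 expr0 mulr1 rmorph1.
rewrite /a -mulrnAl -rmorphMn hS rmorph_sum mulr_suml; apply: eq_bigr => k _.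
have -> : var Lambda i ^+ n = var _ i ^+ k.+1 * var _ i ^+ (n - k.+1).
  by rewrite -exprD subnKC.
apply: etrans (congr1 ( *%R^~ _) (mpolyCM _ _ _)) _.
exact: mulrACA.
Qed.

Let convs (r : seq 'I_N) : nat -> PL :=
  foldr (fun i b => conv (a i) b) (fun n => (n == 0%N)%:R) r.

Let convs_newton r :
  newton (fun k => (psum k)%:MP * \sum_(i <- r) var _ i ^+ k) (convs r).
Proof.
elim: r => [|i r IH] /=.
  by apply: eq_newton (newton_one _) => // k; rewrite big_nil mulr0.
by apply: eq_newton (newton_conv (a_newton i) IH) => // k; rewrite big_cons mulrDr.
Qed.

Let coef_convs r n v : uniq r -> (convs r n)@_(expo v) =
  if [forall i, (i \in r) || (v i == 0%N)] && (\sum_(i <- r) v i == n)%N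
  then \prod_(i <- r) hsym (v i) else 0.
Proof.
elim: r n v => [|i r IH] n v /=.
  rewrite !big_nil [0%N == n]eq_sym => _; case: n => [|n]; last first.
    by rewrite andbF mcoeff0.
  rewrite andbT mcoeff1; have -> : (expo v == 1)%M = [forall i, (i \in [::]) || (v i == 0%N)].
    apply/eqP/forallP => [e i|e]; first by rewrite -expoE e cm1.
    by apply/eqP/cmP => i; rewrite expoE cm1; apply/eqP/e.
  by case: ifP.
case/andP=> ir ur; rewrite /conv raddf_sum /=.
pose c := [forall j, (j \in i :: r) || (v j == 0%N)].
rewrite (eq_bigr (fun k : 'I_n.+1 => if (k == v i :> nat) && (c && (\sum_(j <- i :: r) v j == n)%N)
   then \prod_(j <- i :: r) hsym (v j) else 0)); last first.
  move=> k _; rewrite /a -mulrA coef_CM varX coef_monoM IH //.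
  have -> : [forall j, (i == j) * k <= v j]%N = (k <= v i)%N.
    apply/forallP/idP => [/(_ i)|le j]; first by rewrite eqxx mul1n.
    by case: eqP => [<-|]; rewrite ?mul1n ?mul0n.
  have -> : (\sum_(j <- r) (v j - (i == j) * k) = \sum_(j <- r) v j)%N.
    apply: eq_big_seq => j jr.
    by case: eqP => [e|]; rewrite ?mul0n ?subn0 //; rewrite e jr in ir.
  have -> : \prod_(j <- r) hsym (v j - (i == j) * k) = \prod_(j <- r) hsym (v j).
    apply: eq_big_seq => j jr; congr hsym.
    by case: eqP => [e|]; rewrite ?mul0n ?subn0 //; rewrite e jr in ir.
  have -> : [forall j, (j \in r) || (v j - (i == j) * k == 0)%N] = (v i <= k)%N && c.
    apply/forallP/andP => [H|[le /forallP cH] j].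
      split; first by have := H i; rewrite (negbTE ir) eqxx mul1n subn_eq0.
      apply/forallP => j; have := H j; rewrite in_cons [j == i]eq_sym.
      by case: (eqVneq i j) => //= _; rewrite ?mul0n ?subn0.
    have := cH j; rewrite in_cons [j == i]eq_sym; case: (eqVneq i j) => /= [<- _|_].
      by rewrite mul1n subn_eq0 le orbT.
    by rewrite ?mul0n ?subn0.
  rewrite !big_cons; have lk := ltn_ord k.
  have [lt|lt|e] := ltngtP k (v i); rewrite /= ?mulr0 //.
  rewrite -e; have -> : (k + \sum_(j <- r) v j == n)%N = (\sum_(j <- r) v j == n - k)%N by lia.
  by case: ifP => // _; rewrite mulr0.
have [le|lt] := leqP (v i) n; last first.
  rewrite big1 => [|k _]; last by rewrite ltn_eqF // (leq_ltn_trans _ lt) // -ltnS.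
  by rewrite big_cons (gtn_eqF (ltn_addr _ lt)) andbF.
have lt : (v i < n.+1)%N by [].
rewrite (bigD1 (Ordinal lt)) //= eqxx [X in _ + X]big1 ?addr0 // => k ne.
by rewrite ifF //; apply: contraNF ne => /andP[/eqP e _]; apply/eqP/ord_inj.
Qed.

(** Both sides are the coefficient of x^v in the degree n part of the Cauchy
    kernel prod_(i, j) 1 / (1 - x_i y_j), where Lambda carries the variables y.
    The left side expands the kernel over permutations, the right side as the
    product over i of the series sum_k h_k x_i^k. In terms of characters, the
    Frobenius characteristic of the permutation character on the colourings of
    content v is h_v. *)
Lemma sum_fixed_colorings (i0 : 'I_N) (v : 'I_N -> nat) n : (\sum_i v i = n)%N ->
  (n`!%:R)^-1 *: \sum_(s : 'S_n) (fixed_colorings v s)%:R *: cycle_prod psum s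
  = \prod_i hsym (v i).
Proof.
move=> sv; pose P k : PL := (psum k)%:MP * x k.
have E : eval iota P (cycle_sum psum n)
    = \sum_(s : 'S_n) (cycle_prod psum s)%:MP * cycle_prod x s.
  rewrite /cycle_sum rmorph_sum /=; apply: eq_bigr => s _.
  rewrite eval_cycle_prod /cycle_prod big_split /=; congr (_ * _).
  by rewrite [RHS]rmorph_prod.
have := coef_convs n v (index_enum_uniq _).
have -> : [forall i, (i \in index_enum 'I_N) || (v i == 0%N)] && (\sum_(i <- index_enum 'I_N) v i == n)%N.
  by rewrite sv eqxx andbT; apply/forallP => i; rewrite mem_index_enum.
move=> <-; have -> : convs (index_enum 'I_N) n = eval iota P (hsym n).
  by apply: esym; apply: eval_hsym; apply: convs_newton.
rewrite hsymE evalZ E; apply: esym; apply: etrans (coef_CM _ _ _) _.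
apply: etrans (mul_malgC _ _) _; congr (_ *: _).
apply: etrans (raddf_sum _ _ _ _) _; apply: eq_bigr => s _ /=.
apply: etrans (coef_CM _ _ _) _; rewrite /x (coef_cycle_prod _ i0).
by rewrite mulrC mulr_natl scaler_nat.
Qed.

End Kernel.

(** * Frobenius' formula for Schur coefficients *)

Section Frobenius.
Variable N : nat.
Implicit Types (mu nu : nat -> nat) (f : Lambda).

Definition in_vars : Lambda -> {malg rat[{cmonom 'I_N}]} :=
  psum_eval N (idfun : {rmorphism rat -> rat}).

HB.instance Definition _ := GRing.RMorphism.copy in_vars
  (psum_eval N (idfun : {rmorphism rat -> rat})).

Lemma in_varsZ c f : in_vars (c *: f) = c *: in_vars f.
Proof. by rewrite /in_vars /psum_eval evalZ; apply: mul_malgC. Qed.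

(** In N variables, the product of f with the Vandermonde determinant is the
    sum over lambda of [lambda]f times the alternant of lambda + staircase;
    the coefficient below reads off [mu]f, as long as N bounds the lengths of
    the partitions involved. Applied to p_rho it is the value at rho of the
    irreducible character indexed by mu. *)
Definition frobenius mu f : rat :=
  (alternant rat (@staircase N) * in_vars f)@_(expo (fun i => mu i + staircase i)%N).

Lemma frobeniusD mu f g : frobenius mu (f + g) = frobenius mu f + frobenius mu g.
Proof.
rewrite /frobenius rmorphD; apply: etrans (mcoeffD _ _ _).
by congr (_ @_ _); apply: mulrDr.
Qed.

Lemma frobeniusZ mu c f : frobenius mu (c *: f) = c * frobenius mu f.
Proof.
rewrite /frobenius in_varsZ; apply: etrans (mcoeffZ _ _ _).
by congr (_ @_ _); apply: esym (scalerAr _ _ _).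
Qed.

Lemma frobenius0 mu : frobenius mu 0 = 0.
Proof. by rewrite -(scale0r 0) frobeniusZ mul0r. Qed.

Lemma frobenius_sum mu (I : Type) (r : seq I) (P : pred I) (F : I -> Lambda) :
  frobenius mu (\sum_(i <- r | P i) F i) = \sum_(i <- r | P i) frobenius mu (F i).
Proof. by apply: (big_morph (frobenius mu) (frobeniusD mu) (frobenius0 mu)). Qed.

(** shift mu s is the exponent mu + staircase - s(staircase), which must have
    non-negative entries; it is also the vector of indices of the term s in
    the Jacobi-Trudi determinant of mu. *)
Definition shift_ok mu (s : 'S_N) := [forall i : 'I_N, (i <= mu i + s i)%N].
Definition shift mu (s : 'S_N) (i : 'I_N) : nat := (mu i + s i - i)%N.

Lemma frobeniusE mu f : frobenius mu f =
  \sum_(s : 'S_N) (-1) ^+ s * (if shift_ok mu s then (in_vars f)@_(expo (shift mu s)) else 0).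
Proof.
rewrite /frobenius alternantE.
have -> : (\sum_(s : 'S_N) (-1) ^+ s * mono rat (fun i => staircase (s i))) * in_vars f
   = \sum_(s : 'S_N) (-1) ^+ s * (mono rat (fun i => staircase (s i)) * in_vars f).
  apply: etrans (mulr_suml _ _ _ _) _; apply: eq_bigr => s _.
  exact: esym (mulrA _ _ _).
apply: etrans (raddf_sum _ _ _ _) _; apply: eq_bigr => s _.
apply: etrans (coef_signM _ _ _) _; congr (_ * _).
rewrite coef_monoM; have e (i : 'I_N) : (staircase (s i) <= mu i + staircase i)%N = (i <= mu i + s i)%N.
  by rewrite /staircase; have := ltn_ord i; have := ltn_ord (s i); lia.
have -> : [forall i, (staircase (s i) <= mu i + staircase i)%N] = shift_ok mu s.
  by apply: eq_forallb => i; rewrite e.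
case: ifP => // /forallP ok; congr (_ @_ _); apply: eq_expo => i; have := ok i.
by rewrite /staircase /shift; have := ltn_ord i; have := ltn_ord (s i); lia.
Qed.

Lemma sum_shift mu s : shift_ok mu s -> (\sum_(i < N) shift mu s i = \sum_(i < N) mu i)%N.
Proof.
move=> /forallP ok; apply/eqP; rewrite -(eqn_add2r (\sum_(i < N) i)) -big_split /=.
rewrite [X in (_ + X)%N](reindex_inj (@perm_inj _ s)) -big_split /=.
by apply/eqP/eq_bigr => i _; rewrite /shift subnK // ok.
Qed.

Definition nonincreasing mu := forall i j : nat, (i <= j)%N -> (mu j <= mu i)%N.

(** The vectors mu + staircase and nu + staircase are strictly decreasing, so
    that the only permutation that can carry one to the other is the
    identity. *)
Lemma coef_alternant mu nu : nonincreasing mu -> nonincreasing nu ->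
  (alternant rat (fun i : 'I_N => nu i + staircase i)%N)@_(expo (fun i : 'I_N => mu i + staircase i)%N)
  = [forall i : 'I_N, nu i == mu i]%:R.
Proof.
move=> dmu dnu; rewrite alternantE; apply: etrans (raddf_sum _ _ _ _) _.
rewrite (bigD1 1%g) //= big1 ?addr0 => [|s ns].
  apply: etrans (coef_signM _ _ _) _; rewrite odd_perm1 expr0 mul1r coef_mono.
  by congr (_%:R); congr nat_of_bool; apply: eq_forallb => i; rewrite perm1 eqn_add2r.
apply: etrans (coef_signM _ _ _) _; rewrite coef_mono.
case: forallP => [H|_]; last by rewrite mulr0.
case/eqP: ns; apply/permP => i.
have mono_s (j k : 'I_N) : (j < k)%N -> (s j < s k)%N.
  move=> ljk; have := eqP (H j); have := eqP (H k).
  have := dmu _ _ (ltnW ljk); rewrite /staircase => le1 e1 e2.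
  rewrite ltnNge; apply/negP => le2; have := dnu _ _ le2.
  by have := ltn_ord j; have := ltn_ord k; have := ltn_ord (s j); have := ltn_ord (s k); lia.
have ge (k : nat) (j : 'I_N) : (j = k :> nat) -> (k <= s j)%N.
  elim: k j => // k IH j ej; have lk : (k < N)%N by have := ltn_ord j; lia.
  apply: leq_ltn_trans (IH (Ordinal lk) erefl) _; apply: mono_s => /=; lia.
have le (k : nat) (j : 'I_N) : (j + k = N.-1)%N -> (s j + k <= N.-1)%N.
  elim: k j => [|k IH] j ej; first by have := ltn_ord (s j); lia.
  have lk : (j.+1 < N)%N by have := ltn_ord j; lia.
  have := IH (Ordinal lk); have := mono_s j (Ordinal lk) (leqnn _) => /=; lia.
apply/ord_inj; rewrite perm1; have := ge i i erefl.
by have := le (N.-1 - i)%N i; have := ltn_ord i; lia.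
Qed.

Lemma frobenius_jacobi_trudi mu nu : nonincreasing mu -> nonincreasing nu ->
  frobenius mu (jacobi_trudi N hsym nu) = [forall i : 'I_N, nu i == mu i]%:R.
Proof.
move=> dmu dnu; rewrite -coef_alternant // /frobenius.
by rewrite (psum_eval_jacobi_trudi N idfun).
Qed.

Lemma frobenius_cycle_prod (i0 : 'I_N) mu (T : finType) (s : {perm T}) :
  frobenius mu (cycle_prod psum s) =
  \sum_(t : 'S_N) (-1) ^+ t * (if shift_ok mu t then fixed_colorings (shift mu t) s else 0%N)%:R.
Proof.
rewrite frobeniusE; apply: eq_bigr => t _; congr (_ * _); case: ifP => // _.
by rewrite /in_vars /psum_eval eval_cycle_prod (coef_cycle_prod _ i0).
Qed.

Lemma frobenius_cycle_prod0 (i0 : 'I_N) mu (T : finType) (s : {perm T}) :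
  (\sum_(i < N) mu i != #|T|)%N -> frobenius mu (cycle_prod psum s) = 0.
Proof.
move=> ne; rewrite (frobenius_cycle_prod i0) big1 // => t _.
case: ifP => [ok|_]; last by rewrite mulr0.
by rewrite fixed_colorings0 ?mulr0 // sum_shift.
Qed.

(** The Frobenius characteristic of the class function
    s |-> frobenius mu (p_s) is s_mu: expand the value over permutations of
    the variables, apply the colouring formula to each term, and recognise the
    expansion of the Jacobi-Trudi determinant. *)
Lemma sum_frobenius (i0 : 'I_N) mu n : (\sum_(i < N) mu i = n)%N ->
  (n`!%:R)^-1 *: \sum_(s : 'S_n) frobenius mu (cycle_prod psum s) *: cycle_prod psum s
  = jacobi_trudi N hsym mu.
Proof.
move=> smu.
rewrite (eq_bigr (fun s : 'S_n => \sum_(t : 'S_N) (-1) ^+ t *: (if shift_ok mu t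
   then (fixed_colorings (shift mu t) s)%:R *: cycle_prod psum s else 0))); last first.
  move=> s _; rewrite (frobenius_cycle_prod i0) scaler_suml; apply: eq_bigr => t _.
  apply: etrans (esym (scalerA _ _ _)) _; congr (_ *: _).
  by case: ifP => _; [reflexivity | exact: scale0r].
rewrite exchange_big scaler_sumr; apply: eq_bigr => t _ /=.
rewrite -scaler_sumr scalerA mulrC -scalerA.
rewrite (_ : _ *: \sum_(s : 'S_n) _ = \prod_(i < N) (if (i <= mu i + t i)%N then hsym (mu i + t i - i)%N else 0)); last first.
  case ok: (shift_ok mu t).
    rewrite (sum_fixed_colorings i0) ?sum_shift //; apply: eq_bigr => i _.
    by rewrite (forallP ok i).
  have /negbT/forallPn[i ni] := ok.
  by rewrite big1 // scaler0 (bigD1 i) //= (negbTE ni) mul0r.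
rewrite -signr_odd; under [in RHS]eq_bigr do rewrite mxE.
by case: (odd_perm t) => /=; rewrite ?expr1 ?expr0 ?scaleN1r ?scale1r ?mulN1r ?mul1r.
Qed.

End Frobenius.

Lemma jacobi_trudi_pad N h mu : h 0%N = 1 -> mu N = 0%N ->
  jacobi_trudi N.+1 h mu = jacobi_trudi N h mu.
Proof.
move=> h0 muN; rewrite /jacobi_trudi (expand_det_row _ ord_max) big_ord_recr /=.
rewrite big1 ?add0r => [|j _]; last first.
  by rewrite !mxE /= muN add0n leqNgt ltn_ord /= mul0r.
rewrite !mxE /= muN add0n leqnn subnn h0 mul1r /cofactor -signr_odd oddD addbb mul1r.
congr (\det _); apply/matrixP => i j; rewrite !mxE.
by rewrite !lift_max.
Qed.

Lemma schur_jacobi_trudi N (la : seq nat) : (size la <= N)%N ->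
  schur la = jacobi_trudi N hsym (nth 0%N la).
Proof.
move=> /subnKC <-; elim: (N - size la)%N => [|k IH]; first by rewrite addn0.
rewrite addnS jacobi_trudi_pad //; first exact: hsym_newton.1.
by rewrite nth_default // leq_addr.
Qed.

(** * Schur functions form a basis *)

Lemma sum_ord_perm N (s : 'S_N) (P : pred 'I_N) :
  (forall i j : 'I_N, (i <= j)%N -> P j -> P i) ->
  (\sum_(i | P i) i <= \sum_(i | P i) s i)%N.
Proof.
move=> down; pose A := [set i | P i]; pose B := s @: A.
have eB : (\sum_(i | P i) s i = \sum_(i in B) i)%N.
  rewrite big_imset /=; last by move=> i j _ _; apply: perm_inj.
  by apply: eq_bigl => i; rewrite inE.
have eA : (\sum_(i | P i) i = \sum_(i in A) i)%N by apply: eq_bigl => i; rewrite inE.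
have cAB : #|A :\: B| = #|B :\: A|.
  have cB : #|B| = #|A| by apply: card_imset; exact: perm_inj.
  by apply/eqP; rewrite -(eqn_add2l #|A :&: B|) cardsID setIC cardsID cB.
rewrite eA eB (big_setID B) [X in (_ <= X)%N](big_setID A) /= setIC leq_add2l.
have [->|[x1 x1AB]] := set_0Vmem (A :\: B); first by rewrite big_set0.
case: (@arg_maxnP _ x1 (mem (A :\: B)) (@nat_of_ord N) x1AB) => m mAB maxm.
apply: leq_trans (_ : #|A :\: B| * m <= _)%N.
  by rewrite -sum_nat_const; apply: leq_sum => x /maxm.
rewrite cAB -sum_nat_const; apply: leq_sum => y /setDP[_ yA].
rewrite leqNgt; apply: contra yA => lt; rewrite inE; apply: down (ltnW lt) _.
by move: mAB => /setDP[]; rewrite inE.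
Qed.

(** Writing la i as the number of j < la 0 with j < la i reduces the statement
    to sums over initial segments, where distinct indices have the least
    sum. *)
Lemma rearrangement N (s : 'S_N) (la : nat -> nat) : nonincreasing la ->
  (\sum_(i < N) la i * i <= \sum_(i < N) la i * s i)%N.
Proof.
move=> dla; have E (F : 'I_N -> nat) : (\sum_(i < N) la i * F i
   = \sum_(j < la 0%N) \sum_(i < N | j < la i) F i)%N.
  rewrite (exchange_big_dep xpredT) //=; apply: eq_bigr => i _.
  rewrite sum_nat_const; congr (_ * _)%N.
  rewrite -sum1_card -(big_mkord (fun j => j < la i)%N (fun=> 1%N)).
  have le : (la i <= la 0%N)%N by apply: dla.
  by rewrite -(big_nat_widen _ _ _ xpredT _ le) big_mkord sum1_card card_ord.
rewrite !E; apply: leq_sum => j _; apply: sum_ord_perm => i k ik lt.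
exact: leq_trans lt (dla _ _ ik).
Qed.

(** Each off-diagonal term of the Jacobi-Trudi determinant of la has an index
    vector with a larger sum of squares: that of shift la s is the sum over i
    of (la_i + s_i - i)^2, which exceeds the sum of the la_i^2 by
    2 (sum_i la_i s_i - sum_i la_i i) >= 0 plus a sum of squares that is
    positive unless s is the identity. *)
Lemma sum_sq_shift N (s : 'S_N) (la : nat -> nat) : nonincreasing la -> s != 1%g ->
  shift_ok la s -> (\sum_(i < N) la i ^ 2 < \sum_(i < N) shift la s i ^ 2)%N.
Proof.
move=> dla ns /forallP ok; have re := rearrangement s dla.
have E (i : 'I_N) : (shift la s i ^ 2 + 2 * (la i * i) =
   la i ^ 2 + 2 * (la i * s i) + ((s i - i) ^ 2 + (i - s i) ^ 2))%N.
  have := ok i; rewrite /shift; move: (la i) => a; move: (nat_of_ord (s i)) (nat_of_ord i) => p q le.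
  have [lqp|lpq] := leqP q p.
    have [d ->] : exists d, p = (q + d)%N by exists (p - q)%N; lia.
    have -> : (a + (q + d) - q = a + d)%N by lia.
    have -> : (q + d - q = d)%N by lia.
    by have -> : (q - (q + d) = 0)%N; [lia | ring].
  have [d eq] : exists d, q = (p + d)%N by exists (q - p)%N; lia.
  have [b ->] : exists b, a = (b + d)%N by exists (a - d)%N; lia.
  have -> : (b + d + p - q = b)%N by lia.
  have -> : (p - q = 0)%N by lia.
  by rewrite eq addKn; ring.
have pos : (0 < \sum_(i < N) ((s i - i) ^ 2 + (i - s i) ^ 2))%N.
  rewrite lt0n; apply: contra ns; rewrite sum_nat_eq0 => /forallP H.
  apply/eqP/permP => i; rewrite perm1; apply/ord_inj; have := H i.
  by rewrite addn_eq0 !expn_eq0 !andbT => /andP[]; lia.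
have : (\sum_(i < N) (shift la s i ^ 2 + 2 * (la i * i)) = \sum_(i < N)
   (la i ^ 2 + 2 * (la i * s i) + ((s i - i) ^ 2 + (i - s i) ^ 2)))%N.
  by apply: eq_bigr => i _; apply: E.
by move: re pos; rewrite !big_split /= !big1_eq; lia.
Qed.

Definition sqsum (v : seq nat) : nat := (\sum_(a <- v) a ^ 2)%N.
Definition hprod (v : seq nat) : Lambda := \prod_(a <- v) hsym a.

(** The linear map with mu |-> s_mu; schur_expansion f c says that it sends c
    to f. *)
Definition schur_comb (c : {malg rat[partition]}) : Lambda :=
  mmap (@malgC {cmonom nat} rat) (fun mu : partition => schur mu) c.

Lemma schur_combE c : schur_comb c = \sum_(mu <- msupp c) c@_mu *: schur mu.
Proof. by apply: eq_bigr => mu _; rewrite -mul_malgC. Qed.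

Lemma schur_expansionE f c : schur_expansion f c <-> f = schur_comb c.
Proof. by rewrite schur_combE. Qed.

Lemma schur_combD c d : schur_comb (c + d) = schur_comb c + schur_comb d.
Proof. exact: mmapD. Qed.

Lemma schur_comb0 : schur_comb 0 = 0.
Proof. exact: mmap0. Qed.

Lemma schur_combZ a c : schur_comb (a *: c) = a *: schur_comb c.
Proof.
rewrite /schur_comb (mmapEw (msuppZ_le _ _)) mmapE scaler_sumr.
apply: eq_bigr => mu _; rewrite mcoeffZ.
apply: etrans (mul_malgC _ _) _; apply: esym.
by apply: etrans (congr1 _ (mul_malgC _ _)) _; rewrite scalerA.
Qed.

Lemma schur_combU mu : schur_comb << mu >> = schur mu.
Proof.
by apply: etrans (mmapU _ _) _; apply: etrans (mul_malgC _ _) _; rewrite scale1r.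
Qed.

Lemma partition_nth (la : partition) i : (i < size la)%N -> (0 < nth 0%N la i)%N.
Proof.
move=> lt; have /andP[_ n0] := valP la; rewrite lt0n.
by apply: contra n0 => /eqP <-; apply: mem_nth.
Qed.

Lemma partition_nonincreasing (la : partition) : nonincreasing (nth 0%N la).
Proof.
move=> i j le; have /andP[sla _] := valP la.
have [lt|ge] := ltnP j (size la); last by rewrite nth_default.
have := @sorted_leq_nth _ geq (fun x y z h1 h2 => leq_trans h2 h1) leqnn 0%N la sla.
by apply; rewrite ?inE // (leq_ltn_trans le).
Qed.

Lemma partition_nth_inj N (la mu : partition) : (size la <= N)%N -> (size mu <= N)%N ->
  [forall i : 'I_N, nth 0%N la i == nth 0%N mu i] = (la == mu).
Proof.
move=> sla smu; apply/forallP/eqP => [H|-> //].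
have E i : nth 0%N la i = nth 0%N mu i.
  have [lt|ge] := ltnP i N; first exact: eqP (H (Ordinal lt)).
  by rewrite !nth_default // (leq_trans _ ge).
have es : size la = size mu.
  apply/eqP; rewrite eqn_leq; apply/andP; split; rewrite leqNgt; apply/negP => lt.
    by have := partition_nth lt; rewrite E nth_default.
  by have := partition_nth lt; rewrite -E nth_default.
by apply: val_inj; apply: (@eq_from_nth _ 0%N) => // i _.
Qed.

Lemma frobenius_schur N (mu nu : partition) : (size mu <= N)%N -> (size nu <= N)%N ->
  frobenius N (nth 0%N mu) (schur nu) = (nu == mu)%:R.
Proof.
move=> smu snu; rewrite (schur_jacobi_trudi snu) frobenius_jacobi_trudi ?partition_nth_inj //;
  exact: partition_nonincreasing.
Qed.

(** The number of variables must bound the lengths of mu and of the partitions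
    in the expansion; hence the form for all sufficiently large N, which
    determines the coefficients. *)
Lemma frobenius_schur_comb (c : {malg rat[partition]}) (mu : partition) :
  exists N0, forall N, (N0 <= N)%N -> frobenius N (nth 0%N mu) (schur_comb c) = c@_mu.
Proof.
exists (\max_(nu <- mu :: msupp c) size nu)%N => N.
rewrite big_cons geq_max => /andP[smu snu].
have {}snu (nu : partition) : nu \in msupp c -> (size nu <= N)%N.
  by move=> h; apply: leq_trans snu; rewrite (big_rem nu) //= leq_maxl.
rewrite schur_combE frobenius_sum.
transitivity (\sum_(nu <- msupp c) << c@_nu *g nu >>@_mu); last first.
  by rewrite {3}(monalgE c); apply: esym (raddf_sum _ _ _ _).
rewrite big_seq [RHS]big_seq.
apply: eq_bigr => nu h; rewrite frobeniusZ (frobenius_schur smu (snu _ h)) mcoeffU.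
by rewrite mulr_natr.
Qed.

(** The sum of squares plays the role of a dominance order: h_la is s_la plus
    Schur functions with a larger sum of squares. *)
Definition span_ge k f :=
  exists2 c, f = schur_comb c & forall mu : partition, c@_mu != 0 -> (k <= sqsum mu)%N.

Lemma span_ge0 k : span_ge k 0.
Proof. by exists 0 => [|mu]; rewrite ?schur_comb0 // mcoeff0 eqxx. Qed.

Lemma span_geD k f g : span_ge k f -> span_ge k g -> span_ge k (f + g).
Proof.
move=> [c -> Hc] [d -> Hd]; exists (c + d); first by rewrite schur_combD.
move=> mu; rewrite mcoeffD; have [->|/Hc //] := eqVneq c@_mu 0.
by rewrite add0r => /Hd.
Qed.

Lemma span_geZ k a f : span_ge k f -> span_ge k (a *: f).
Proof.
move=> [c -> Hc]; exists (a *: c); first by rewrite schur_combZ.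
by move=> mu; rewrite mcoeffZ mulf_eq0 => /norP[_ /Hc].
Qed.

Lemma span_geW k l f : (k <= l)%N -> span_ge l f -> span_ge k f.
Proof. by move=> le [c e H]; exists c => // mu /H; apply: leq_trans. Qed.

Lemma span_ge_schur (mu : partition) : span_ge (sqsum mu) (schur mu).
Proof.
exists << mu >>; first by rewrite schur_combU.
by move=> nu; rewrite mcoeffU; case: (eqVneq mu nu) => [<- //|_]; rewrite mulr0n eqxx.
Qed.

(** The diagonal term of the Jacobi-Trudi determinant of la is h_la, and the
    other terms are products of complete functions with a larger sum of
    squares. *)
Lemma schur_hprod (la : partition) :
  (forall w, sumn w = sumn la -> (sqsum la < sqsum w)%N -> span_ge (sqsum w) (hprod w)) ->
  span_ge (sqsum la).+1 (hprod la - schur la).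
Proof.
move=> IH; rewrite /schur -/(jacobi_trudi (size la) hsym (nth 0%N la)).
set N := size la; pose v (s : 'S_N) := [seq shift (nth 0%N la) s i | i : 'I_N].
have lae : la = [seq nth 0%N la (i : 'I_N) | i : 'I_N] :> seq nat.
  by rewrite -[LHS](mkseq_nth 0%N) /mkseq -val_enum_ord -map_comp.
rewrite /jacobi_trudi /determinant (bigD1 1%g) //= odd_perm1 expr0 mul1r opprD addrA.
rewrite (_ : hprod la - _ = 0) ?add0r; last first.
  apply/eqP; rewrite subr_eq0; apply/eqP; rewrite /hprod {1}lae big_image.
  by apply: eq_bigr => i _; rewrite mxE perm1 leq_addl addnK.
rewrite -scaleN1r; apply: span_geZ.
apply: big_ind => [||s ns]; [exact: span_ge0|exact: span_geD|].
have -> : (-1) ^+ s * \prod_i (\matrix_(i < N, j < N) (if (i <= nth 0 la i + j)%N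
   then hsym (nth 0 la i + j - i) else 0)) i (s i) 
  = (-1) ^+ s *: (if shift_ok (nth 0%N la) s then hprod (v s) else 0).
  transitivity ((-1) ^+ s * (if shift_ok (nth 0%N la) s then hprod (v s) else 0)).
    congr (_ * _); case: ifP => [/forallP ok|/negbT/forallPn[i ni]].
      rewrite /hprod big_image; apply: eq_bigr => i _; rewrite mxE.
      by have := ok i; rewrite /shift => ->.
    by rewrite (bigD1 i) //= mxE (negbTE ni) mul0r.
  by case: (odd_perm s); rewrite ?expr1 ?expr0 ?mulN1r ?scaleN1r ?mul1r ?scale1r.
apply: span_geZ; case: ifP => [ok|_]; last exact: span_ge0.
have lt : (sqsum la < sqsum (v s))%N.
  rewrite /sqsum {1}lae !big_image; apply: sum_sq_shift => //.
  exact: partition_nonincreasing.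
apply: span_geW lt (IH _ _ lt).
by rewrite {1}lae !sumnE !big_image; apply: sum_shift.
Qed.

Lemma sqsum_le v : (sqsum v <= sumn v ^ 2)%N.
Proof.
elim: v => [|a v IH]; first by rewrite /sqsum big_nil.
by rewrite /sqsum big_cons /= -/(sqsum v); nia.
Qed.

Lemma partition_of_seq (v : seq nat) :
  is_partition (sort geq [seq a <- v | (0 < a)%N]).
Proof.
rewrite /is_partition sort_sorted /=; last by move=> x y; apply: leq_total.
by rewrite mem_sort mem_filter.
Qed.

(** Induction on (sumn v)^2 - sqsum v, after sorting v and dropping zeros. *)
Lemma span_ge_hprod v : span_ge (sqsum v) (hprod v).
Proof.
have [m] := ubnP (sumn v ^ 2 - sqsum v)%N; elim: m v => // m IH v.
rewrite ltnS => lm; pose la := Partition (partition_of_seq v).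
have red (F : nat -> nat) : F 0%N = 0%N -> (\sum_(a <- la) F a = \sum_(a <- v) F a)%N.
  move=> F0; rewrite (perm_big [seq a <- v | (0 < a)%N]) ?perm_sort //= big_filter.
  by rewrite big_mkcond; apply: eq_bigr => -[|a] _ //.
have sq : sqsum la = sqsum v by apply: red.
have sm : sumn la = sumn v by rewrite !sumnE; apply: (red id).
have hp : hprod v = hprod la.
  rewrite [RHS](perm_big [seq a <- v | (0 < a)%N]) ?perm_sort //= big_filter.
  rewrite [RHS]big_mkcond; apply: eq_bigr => -[|a] _ //; exact: hsym_newton.1.
rewrite hp -sq -(subrK (schur la) (hprod la)); apply: span_geD; last exact: span_ge_schur.
apply: span_geW (leqnSn _) _; apply: schur_hprod => w sw lt; apply: IH.
by have := sqsum_le w; rewrite sw sm; lia.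
Qed.

(** The coefficient of s_la in h_la is 1; it is what makes the characters of
    the symmetric group below irreducible rather than opposite to irreducible
    ones. *)
Lemma frobenius_hprod (la : partition) :
  exists N0, forall N, (N0 <= N)%N -> frobenius N (nth 0%N la) (hprod la) = 1.
Proof.
have [c e Hc] : span_ge (sqsum la).+1 (hprod la - schur la).
  by apply: schur_hprod => w _ _; apply: span_ge_hprod.
have [N0 H] := frobenius_schur_comb (<< la >> + c) la.
exists N0 => N le; have := H N le; rewrite schur_combD schur_combU -e addrC subrK => ->.
rewrite mcoeffD mcoeffUU; have [->|/Hc] := eqVneq c@_la 0; first by rewrite addr0.
by rewrite ltnn.
Qed.

(* Unfolding the average over the symmetric group during unification is very
   slow. *)
#[local] Opaque hsym.

(** The products of complete functions lie in the span of the Schur functions,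
    and Newton's identities express the power sums through them. *)
Lemma schur_span f : exists c, schur_expansion f c.
Proof.
pose good g := forall v, span_ge 0 (g * hprod v).
suff H : good f.
  have := H [::]; rewrite /hprod big_nil mulr1 => -[c e _].
  by exists c; apply/schur_expansionE.
elim/Lambda_ind: f => [f g Hf Hg|c f Hf||k f Hf] v.
- by rewrite mulrDl; apply: span_geD.
- by rewrite -scalerAl; apply: span_geZ.
- by rewrite mul1r; apply: span_geW (span_ge_hprod v).
have [n] := ubnP k; elim: n k v => // n IH k v; rewrite ltnS => le.
have E : psum k.+1 = hsym k.+1 *+ k.+1 - \sum_(j < k) psum j.+1 * hsym (k.+1 - j.+1)%N.
  have gen (a b c : Lambda) : a = b + c -> c = a - b by move=> ->; rewrite addrC addKr.
  apply: gen; apply: etrans (hsym_newton.2 k.+1) _; rewrite big_ord_recr; congr (_ + _).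
  by rewrite /= subnn hsym_newton.1; apply: mulr1.
rewrite E -mulrA mulrBl mulr_suml; apply: span_geD.
  rewrite -scaler_nat -scalerAl; apply: span_geZ.
  by rewrite mulrCA; have := Hf (k.+1 :: v); rewrite /hprod big_cons.
rewrite -scaleN1r; apply: span_geZ.
apply: big_ind => [||j _]; [exact: span_ge0|exact: span_geD|].
have := IH j ((k.+1 - j.+1)%N :: v); rewrite (leq_trans (ltn_ord j) le) => /(_ isT).
move=> H; apply: (eq_ind_r (span_ge 0) H).
by rewrite /hprod big_cons; apply: mulrACA.
Qed.

Lemma schur_coef_expansion f : schur_expansion f (epsilon (inhabits 0) (schur_expansion f)).
Proof. exact: epsilon_spec (schur_span f). Qed.

(** Any expansion of f has these coefficients; this is how the coefficients
    are computed from here on. *)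
Lemma frobenius_schur_coef (mu : partition) f :
  exists N0, forall N, (N0 <= N)%N -> frobenius N (nth 0%N mu) f = schur_coef mu f.
Proof.
have /schur_expansionE e := schur_coef_expansion f.
by have [N0 H] := frobenius_schur_comb (epsilon (inhabits 0) (schur_expansion f)) mu; exists N0 => N /H; rewrite -e.
Qed.

Definition schur_supp f : {fset partition} := msupp (epsilon (inhabits 0) (schur_expansion f)).

Lemma schur_suppP f (mu : partition) : (mu \in schur_supp f) = (schur_coef mu f != 0).
Proof. by rewrite -mcoeff_neq0. Qed.

Lemma schur_sum f : f = \sum_(mu <- schur_supp f) schur_coef mu f *: schur mu.
Proof. exact: schur_coef_expansion. Qed.

(** * Characters of the symmetric group *)

Local Notation QtoC := (ratr : rat -> algC).

Section FullGroup.
Variables (gT : finGroupType).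
Notation G := [set: gT]%G.

Lemma cfRepr_full d (rG : mx_representation algC G d) g : cfRepr rG g = \tr (rG g).
Proof. by rewrite cfunE in_setT. Qed.

Section PermutationCharacter.
Variables (T : finType) (to : T -> gT -> T) (X : {set T}).
Hypotheses (to1 : forall x, to x 1%g = x) (toM : forall x g h, to x (g * h)%g = to (to x g) h).
Hypothesis Xto : forall x g, x \in X -> to x g \in X.

Let M g : 'M[algC]_#|X| := \matrix_(i, j) (to (enum_val i) g == enum_val j)%:R.

Let M_repr : mx_repr G M.
Proof.
split=> [|g h _ _]; apply/matrixP => i j; rewrite !mxE.
  by rewrite to1 (inj_eq enum_val_inj).
have Xi : to (enum_val i) g \in X by apply: Xto; apply: enum_valP.
rewrite (bigD1 (enum_rank_in Xi (to (enum_val i) g))) //= !mxE enum_rankK_in // eqxx mul1r -toM.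
rewrite big1 ?addr0 // => k nk; rewrite !mxE; case: eqP => [e|]; last by rewrite mul0r.
case/eqP: nk; apply: enum_val_inj; rewrite enum_rankK_in //.
Qed.

(** The permutation character of a right action, given by its action
    function, on a stable subset X. *)
Definition perm_char : 'CF(G) := cfRepr (MxRepresentation M_repr).

Lemma perm_char_char : perm_char \is a character.
Proof. exact: cfRepr_char. Qed.

Lemma perm_charE g : perm_char g = #|[set x in X | to x g == x]|%:R.
Proof.
rewrite cfRepr_full /mxtrace (eq_bigr (fun i => if to (enum_val i) g == enum_val i then 1 else 0)).
  transitivity (\sum_(x in X | to x g == x) 1 : algC).
    by rewrite big_enum_val_cond -big_mkcond.
  by rewrite sumr_const; congr (_%:R); apply: eq_card => x; rewrite !inE.
by move=> i _; rewrite mxE; case: ifP.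
Qed.

End PermutationCharacter.

End FullGroup.

Section SymmetricGroup.
Variables (N n : nat) (i0 : 'I_N).
Notation G := [set: 'S_n]%G.

Let act (phi : {ffun 'I_n -> 'I_N}) (s : 'S_n) : {ffun 'I_n -> 'I_N} := [ffun t => phi ((s^-1)%g t)].

Let act1 phi : act phi 1%g = phi.
Proof. by apply/ffunP => t; rewrite ffunE invg1 perm1. Qed.

Let actM phi g h : act phi (g * h)%g = act (act phi g) h.
Proof. by apply/ffunP => t; rewrite !ffunE invMg permM. Qed.

Let act_content phi s v : phi \in colorings _ v -> act phi s \in colorings _ v.
Proof.
rewrite !inE => /forallP H; apply/forallP => i; rewrite -(eqP (H i)); apply/eqP.
rewrite /content (reindex_inj (@perm_inj _ s)) /=.
by apply: eq_bigr => t _; rewrite ffunE permK.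
Qed.

Definition coloring_char (v : 'I_N -> nat) : 'CF(G) :=
  perm_char act1 actM (X := colorings _ v) (fun phi s => @act_content phi s v).

Lemma coloring_charE v s : coloring_char v s = (fixed_colorings v s)%:R.
Proof.
rewrite perm_charE; congr (_%:R); rewrite /fixed_colorings; apply: eq_card => phi.
rewrite !inE andbC; congr (_ && _); apply/eqP/forallP => [/ffunP H t|H].
  by have := H (s t); rewrite ffunE permK => ->.
by apply/ffunP => t; rewrite ffunE -{2}(permKV s t) (eqP (H _)).
Qed.

(** The determinant of Jacobi-Trudi with permutation characters in place of
    products of complete functions: an integral combination of characters,
    hence a virtual character. *)
Definition frobenius_char (mu : nat -> nat) : 'CF(G) :=
  \sum_(t : 'S_N) (-1) ^+ t *: (if shift_ok mu t then coloring_char (shift mu t) else 0).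

Lemma frobenius_charE mu s : frobenius_char mu s = QtoC (frobenius N mu (cycle_prod psum s)).
Proof.
rewrite (frobenius_cycle_prod i0) rmorph_sum sum_cfunE /=; apply: eq_bigr => t _.
rewrite rmorphM rmorph_sign cfunE rmorph_nat; congr (_ * _).
by case: ifP => _; rewrite ?coloring_charE ?cfunE.
Qed.

Lemma frobenius_char_vchar mu : frobenius_char mu \in 'Z[irr G]%g.
Proof.
apply: rpred_sum => t _; rewrite -signr_odd; case: (odd_perm t) => /=.
  rewrite expr1 scaleN1r rpredN; case: ifP => _; last exact: rpred0.
  by apply: char_vchar; apply: perm_char_char.
rewrite expr0 scale1r; case: ifP => _; last exact: rpred0.
by apply: char_vchar; apply: perm_char_char.
Qed.

(** The scalar product with the character of mu is the coefficient of s_mu in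
    the Frobenius characteristic. *)
Lemma cfdot_frobenius_char mu (a : 'S_n -> rat) (phi : 'CF(G)) :
  (forall s, phi s = QtoC (a s)) -> '[phi, frobenius_char mu] =
  QtoC (frobenius N mu ((n`!%:R)^-1 *: \sum_(s : 'S_n) a s *: cycle_prod psum s)).
Proof.
move=> Ha; rewrite frobeniusZ frobenius_sum cfdotE cardsT card_Sn rmorphM fmorphV rmorph_nat.
congr (_ * _); rewrite rmorph_sum; apply: eq_big => [s|s _]; first by rewrite in_setT.
rewrite Ha frobenius_charE frobeniusZ (conj_Crat (Crat_rat _)).
exact: esym (rmorphM _ _ _).
Qed.

End SymmetricGroup.

Lemma sum_nth N (la : seq nat) : (size la <= N)%N -> (\sum_(i < N) nth 0 la i = sumn la)%N.
Proof.
move=> sN; rewrite sumnE (big_nth 0%N) big_mkord (big_ord_widen _ (fun i => nth 0%N la i) sN).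
rewrite [RHS]big_mkcond; apply: eq_bigr => i _; case: ltnP => // ge.
by rewrite nth_default.
Qed.

(** A virtual character of norm 1 is, up to sign, irreducible. The norm is the
    coefficient of s_la in s_la. The sign is positive because the scalar
    product with the permutation character of h_la is the coefficient of s_la
    in h_la, which is 1. *)
Lemma frobenius_char_char (la : partition) : exists N0, forall N (i0 : 'I_N), (N0 <= N)%N ->
  frobenius_char N (sumn la) (nth 0%N la) \is a character.
Proof.
have [N0 H0] := frobenius_hprod la; exists (maxn N0 (size la)) => N i0.
rewrite geq_max => /andP[/H0 h1 sN]; set n := sumn la; set chi := frobenius_char _ _ _.
have sla : (\sum_(i < N) nth 0 la i = n)%N by apply: sum_nth.
have n1 : '[chi] = 1.
  rewrite (@cfdot_frobenius_char N n i0 _ (fun s => frobenius N (nth 0%N la) (cycle_prod psum s))); last first.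
    by move=> s; apply: frobenius_charE.
  rewrite (sum_frobenius i0 sla) -(schur_jacobi_trudi sN) frobenius_schur // eqxx.
  by rewrite rmorph1.
have pos : '[coloring_char n (fun i : 'I_N => nth 0%N la i), chi] = 1.
  rewrite (@cfdot_frobenius_char N n i0 _ (fun s => (fixed_colorings (fun i : 'I_N => nth 0%N la i) s)%:R)); last first.
    by move=> s; rewrite coloring_charE rmorph_nat.
  rewrite (sum_fixed_colorings i0 sla).
  suff -> : \prod_(i < N) hsym (nth 0%N la i) = hprod la by rewrite h1 rmorph1.
  rewrite /hprod (big_nth 0%N) big_mkord (big_ord_widen _ (fun i => hsym (nth 0%N la i)) sN).
  rewrite [RHS]big_mkcond; apply: eq_bigr => i _; case: ltnP => // ge.
  by rewrite nth_default // hsym_newton.1.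
have [[] [i e]] := vchar_norm1P (frobenius_char_vchar _ _ _) n1; last first.
  by rewrite /chi e scale1r irr_char.
have := pos; rewrite /chi e expr1 scaleN1r cfdotNr => h.
have := Cnat_cfdot_char_irr i (perm_char_char _ _ _ : coloring_char n (fun i : 'I_N => nth 0%N la i) \is a character).
have {}h := esym (congr1 -%R h); rewrite opprK in h.
by rewrite -h => /natr_ge0; rewrite oppr_ge0 ler10.
Qed.

Section Realization.
Variables (gT : finGroupType) (m : nat) (iota : gT -> 'S_m).
Hypothesis iotaM : {morph iota : x y / (x * y)%g}.

(** The coefficient of s_mu is the scalar product of psi with the pull-back
    along iota of the character of mu, by Frobenius reciprocity: the symmetric
    function is the characteristic of the character of S_m induced by psi. A
    scalar product of two characters is a natural number. *)
Lemma schur_coef_nat (psi : 'CF([set: gT])) (a : gT -> rat) (f : Lambda) (mu : partition) :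
  psi \is a character -> (forall g, psi g = QtoC (a g)) ->
  f = #|gT|%:R^-1 *: \sum_g a g *: cycle_prod psum (iota g) ->
  schur_coef mu f \is a Num.nat.
Proof.
move=> char_psi psiE ->; set F := _ *: _.
have [N1 H1] := frobenius_schur_coef mu F.
have [N2 H2] := frobenius_char_char mu.
pose N := maxn (size mu) (maxn N1 N2); have i0 : 'I_N.+1 by exact: ord0.
rewrite -(H1 N.+1) /N; last by lia.
rewrite -/N /F frobeniusZ frobenius_sum.
have [e|ne] := eqVneq (sumn mu) m; last first.
  rewrite big1 ?mulr0 ?rpred0 // => g _.
  rewrite frobeniusZ (frobenius_cycle_prod0 i0) ?mulr0 // card_ord sum_nth //.
  by rewrite /N; lia.
have := H2 N.+1 i0; rewrite (_ : (N2 <= N.+1)%N) => [/(_ isT)|]; last by rewrite /N; lia.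
rewrite e => /char_reprP[[d rho] /= rhoE].
pose r g : 'M[algC]_d := rho (iota g).
have r_repr : mx_repr [set: gT] r.
  split=> [|x y _ _]; last by rewrite /r iotaM repr_mxM ?in_setT.
  have -> : r 1%g = rho 1%g; last exact: repr_mx1.
  by congr (rho _); apply: (mulgI (iota 1%g)); rewrite -iotaM !mulg1.
have := Cnat_cfdot_char char_psi (cfRepr_char (MxRepresentation r_repr)).
rewrite cfdotE cardsT.
rewrite (eq_bigr (fun g => QtoC (frobenius N.+1 (nth 0%N mu) (a g *: cycle_prod psum (iota g))))); last first.
  move=> g _; rewrite psiE cfRepr_full /= /r -(cfRepr_full rho) -rhoE (frobenius_charE i0).
  by rewrite (conj_Crat (Crat_rat _)) frobeniusZ; apply: esym; apply: rmorphM.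
rewrite (eq_bigl xpredT); last by move=> g; rewrite in_setT.
rewrite -rmorph_sum -(rmorph_nat (ratr : {rmorphism rat -> algC})) -fmorphV -rmorphM.
move=> /natrP[k]; rewrite -(rmorph_nat (ratr : {rmorphism rat -> algC})) => /fmorph_inj ->.
exact: natr_nat.
Qed.

End Realization.

(** * The wreath product with a group of order 2 *)

(** Two elements of the base group and a flag: whether the two copies are
    exchanged. *)
Definition wreath2 (gT : finGroupType) : Type := (gT * gT * bool)%type.

Section Wreath.
Variable gT : finGroupType.
Local Open Scope group_scope.
Notation K := (wreath2 gT).

HB.instance Definition _ := Finite.copy K (gT * gT * bool)%type.

Definition wreath2_mul (g h : K) : K :=
  let: (a, b, e) := g in let: (c, d, e') := h in
  if e then (a * d, b * c, ~~ e') else (a * c, b * d, e').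

Definition wreath2_one : K := (1, 1, false).

Definition wreath2_inv (g : K) : K :=
  let: (a, b, e) := g in if e then (b^-1, a^-1, true) else (a^-1, b^-1, false).

Fact wreath2_mulA : associative wreath2_mul.
Proof. by move=> [[a b] []] [[c d] []] [[x y] []]; rewrite /wreath2_mul /= !mulgA. Qed.

Fact wreath2_mul1 : left_id wreath2_one wreath2_mul.
Proof. by move=> [[a b] e]; rewrite /wreath2_mul /= !mul1g. Qed.

Fact wreath2_mulV : left_inverse wreath2_one wreath2_inv wreath2_mul.
Proof. by move=> [[a b] []]; rewrite /wreath2_mul /= !mulVg. Qed.

HB.instance Definition _ := Finite_isGroup.Build K wreath2_mulA wreath2_mul1 wreath2_mulV.

Lemma sum_wreath2 (V : zmodType) (F : K -> V) :
  (\sum_g F g = \sum_a \sum_b F (a, b, false) + \sum_a \sum_b F (a, b, true))%R.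
Proof.
transitivity (\sum_a \sum_b \sum_(e : bool) F (a, b, e))%R.
  by rewrite pair_bigA pair_bigA; apply: eq_bigr => -[[a b] e].
rewrite -big_split; apply: eq_bigr => a _; rewrite -big_split; apply: eq_bigr => b _.
by rewrite big_bool; apply: addrC.
Qed.

Lemma card_wreath2 : #|{: K}| = (2 * #|gT| ^ 2)%N.
Proof. by rewrite (card_prod (gT * gT)%type bool) card_prod card_bool mulnC. Qed.

End Wreath.

Section WreathPerm.
Variable n : nat.

(** The action on two copies of n points: each component acts on its copy,
    then the copies are exchanged if the flag is set. *)
Definition swap2_fun (g : wreath2 'S_n) (x : 'I_(n + n)) : 'I_(n + n) :=
  let: (a, b, e) := g in
  unsplit (match split x with
           | inl i => if e then inr (a i) else inl (a i)
           | inr i => if e then inl (b i) else inr (b i)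
           end).

Let swap2M (g h : wreath2 'S_n) x : swap2_fun (g * h)%g x = swap2_fun h (swap2_fun g x).
Proof.
by case: g h => [[a b] []] [[c d] []]; rewrite /swap2_fun /=; case: (split x) => i;
  rewrite unsplitK /= permM.
Qed.

Let swap2_1 x : swap2_fun 1%g x = x.
Proof. by rewrite -[RHS]splitK /=; case: (split x) => i; rewrite perm1. Qed.

Fact swap2_inj g : injective (swap2_fun g).
Proof. by apply: (can_inj (g := swap2_fun g^-1%g)) => x; rewrite -swap2M mulgV swap2_1. Qed.

Definition wreath2_perm g : 'S_(n + n) := perm (@swap2_inj g).

Lemma wreath2_permM : {morph wreath2_perm : g h / (g * h)%g}.
Proof. by move=> g h; apply/permP => x; rewrite permM !permE swap2M. Qed.

Section Cycles.
Variables (R : comNzRingType) (p : nat -> R) (a b : 'S_n).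

Let L : 'I_n -> 'I_(n + n) := @lshift n n.
Let U : 'I_n -> 'I_(n + n) := @rshift n n.

Let LI : injective L. Proof. exact: lshift_inj. Qed.
Let UI : injective U. Proof. exact: rshift_inj. Qed.
Let LU i j : (L i == U j) = false. Proof. exact: eq_lrshift. Qed.

Let LUP x : {i | x = L i} + {i | x = U i}.
Proof. by case: (splitP x) => i e; [left|right]; exists i; apply: ord_inj. Qed.

Let splitL i : split (L i) = inl i. Proof. exact: (@unsplitK n n (inl i)). Qed.
Let splitU i : split (U i) = inr i. Proof. exact: (@unsplitK n n (inr i)). Qed.

Lemma cycle_prod_wreath2 :
  cycle_prod p (wreath2_perm (a, b, false)) = cycle_prod p a * cycle_prod p b.
Proof.
set s := wreath2_perm _.
have sL i : L (a i) = s (L i) by rewrite permE /swap2_fun splitL.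
have sU i : U (b i) = s (U i) by rewrite permE /swap2_fun splitU.
rewrite /cycle_prod -(prod_imset_porbits p LI) -(prod_imset_porbits p UI) -bigU /=.
  apply: eq_bigl => c; rewrite !inE (imset_porbits sL) (imset_porbits sU).
  apply/imsetP/orP => [[x _ ->]|[] /imsetP[x _ ->]]; [|by exists x|by exists x].
  by case: (LUP x) => -[i ->]; [left|right]; apply: imset_f; apply: codom_f.
rewrite -setI_eq0; apply/eqP/setP => c; rewrite !inE; apply/negbTE/negP.
case/andP=> /imsetP[c1 /imsetP[i _ ->] ->] /imsetP[c2 _ /setP /(_ (L i))].
rewrite imset_f ?porbit_id // => /esym /imsetP[j _ /eqP].
by rewrite LU.
Qed.

(** When the copies are exchanged, a cycle visits them alternately, and two
    steps from the first copy amount to a * b. So D maps a cycle c of a * b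
    to a cycle with twice as many points: c in the first copy, and its image
    by a in the second one. *)
Lemma cycle_prod_wreath2_swap :
  cycle_prod p (wreath2_perm (a, b, true)) = cycle_prod (fun k => p (2 * k)%N) (a * b)%g.
Proof.
set s := wreath2_perm _.
have sL i : s (L i) = U (a i) by rewrite permE /swap2_fun splitL.
have sU i : s (U i) = L (b i) by rewrite permE /swap2_fun splitU.
pose D (c : {set 'I_n}) := L @: c :|: U @: (a @: c).
have DL c i : (L i \in D c) = (i \in c).
  rewrite in_setU mem_imset // orbC; case: imsetP => // -[j _ /eqP].
  by rewrite LU.
have DU c i : (U (a i) \in D c) = (i \in c).
  rewrite in_setU !mem_imset //; last exact: perm_inj.
  by case: imsetP => // -[j _ /esym /eqP]; rewrite LU.
have DI : injective D by move=> c d e; apply/setP => i; rewrite -!DL e.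
have porL i : porbit s (L i) = D (porbit (a * b)%g i).
  apply/eqP; rewrite eqEsubset; apply/andP; split.
    apply: porbit_sub; last by rewrite DL porbit_id.
    move=> x; case: (LUP x) => -[j ->]; first by rewrite sL DL DU.
    rewrite -(permKV a j) sU DU DL => h.
    by rewrite -permM porbit_step.
  have HL j : j \in porbit (a * b)%g i -> L j \in porbit s (L i).
    case/porbitP => k ->; elim: k => [|k IH]; first by rewrite expg0 perm1 porbit_id.
    by rewrite expgSr !permM -sU -sL; apply: porbit_step; apply: porbit_step.
  apply/subsetP => x; case: (LUP x) => -[j ->]; first by rewrite DL => /HL.
  by rewrite -(permKV a j) DU -sL => /HL; apply: porbit_step.
have porU i : porbit s (U i) = porbit s (L ((a^-1)%g i)).
  apply/eqP; rewrite eq_porbit_mem -{1}(permKV a i) -sL; apply: porbit_step.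
  exact: porbit_id.
have -> : cycle_prod p s = \prod_(c in [set D c | c in porbits (a * b)%g]) p #|c|.
  apply: eq_bigl => c; apply/imsetP/imsetP => [[x _ ->]|[d /imsetP[i _ ->] ->]].
    case: (LUP x) => -[i ->]; rewrite ?porU porL; last by eexists; last reflexivity; apply: imset_f.
    by eexists; last reflexivity; apply: imset_f.
  by exists (L i); rewrite ?porL.
rewrite big_imset /=; last by move=> c d _ _; apply: DI.
apply: eq_bigr => c _; congr p; rewrite cardsU !card_imset //; last exact: perm_inj.
rewrite (_ : _ :&: _ = set0) ?cards0 ?subn0 ?mul2n ?addnn //.
apply/setP => x; rewrite !inE; apply/negbTE/negP => /andP[/imsetP[i _ ->] /imsetP[j _ /eqP]].
by rewrite LU.
Qed.

End Cycles.
End WreathPerm.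

Section WreathChar.
Variables (gT : finGroupType) (d : nat) (rho : mx_representation algC [set: gT] d) (sgn : bool).

(* The tensor square of V is realised as the matrices X of size d, on which (a, b) acts by
   X |-> rho(a)^T X rho(b) and the exchange by transposition, up to the sign. *)
Let act2 (A B : 'M[algC]_d) : 'M[algC]_d -> 'M[algC]_d := mulmxr B \o mulmx A^T.
Let act2T (A B : 'M[algC]_d) : 'M[algC]_d -> 'M[algC]_d := trmx \o (mulmxr B \o mulmx A^T).

HB.instance Definition _ A B := GRing.Linear.copy (act2 A B) (mulmxr B \o mulmx A^T).
HB.instance Definition _ A B := GRing.Linear.copy (act2T A B) (trmx \o (mulmxr B \o mulmx A^T)).

Let r (g : wreath2 gT) : 'M[algC]_(d * d) :=
  let: (a, b, e) := g in
  if e then (-1) ^+ sgn *: lin_mx (act2T (rho a) (rho b)) else lin_mx (act2 (rho a) (rho b)).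

(* The action, before it is encoded as a matrix of size d * d. *)
Let F (g : wreath2 gT) (X : 'M[algC]_d) : 'M[algC]_d :=
  let Y := (rho g.1.1)^T *m X *m rho g.1.2 in if g.2 then (-1) ^+ sgn *: Y^T else Y.

Let rE (g : wreath2 gT) X : mxvec X *m r g = mxvec (F g X).
Proof.
case: g => [[a b] []]; rewrite /r /F /=; last by rewrite mul_vec_lin.
by rewrite -scalemxAr mul_vec_lin linearZ.
Qed.

Let r_repr : mx_repr [set: wreath2 gT] r.
Proof.
have ext (A B : 'M[algC]_(d * d)) : (forall X : 'M_d, mxvec X *m A = mxvec X *m B) -> A = B.
  by move=> e; apply/row_matrixP => i; rewrite !rowE -[delta_mx 0 i]vec_mxK e.
split=> [|g h _ _]; apply: ext => X.
  by rewrite (rE 1%g) /F /= !repr_mx1 trmx1 mul1mx !mulmx1.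
have rM a b : rho (a * b)%g = rho a *m rho b by rewrite repr_mxM ?in_setT.
rewrite mulmxA !rE; congr mxvec; rewrite /F.
case: g h => [[a b] []] [[c e] []] /=; rewrite !rM ?trmx_mul ?trmxK ?mulmxA //.
- rewrite [(_ *: _)^T]linearZ /= -scalemxAr -scalemxAl scalerA -signr_addb addbb scale1r.
  by rewrite !trmx_mul !trmxK !mulmxA.
- by rewrite -!scalemxAr -!scalemxAl !mulmxA.
Qed.

Definition wreath2_char : 'CF([set: wreath2 gT]) := cfRepr (MxRepresentation r_repr).

Lemma wreath2_char_char : wreath2_char \is a character.
Proof. exact: cfRepr_char. Qed.

Let trace_lin_mx (f : {linear 'M[algC]_d -> 'M[algC]_d}) :
  \tr (lin_mx f) = \sum_i \sum_j f (delta_mx i j) i j.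
Proof.
rewrite /mxtrace (reindex _ (curry_mxvec_bij _ _)) /= pair_bigA; apply: eq_bigr => -[i j] _ /=.
transitivity (row (mxvec_index i j) (lin_mx f) 0 (mxvec_index i j)); first by rewrite [RHS]mxE.
by rewrite rowE -mxvec_delta mul_vec_lin mxvecE.
Qed.

Let mul_delta (A B : 'M[algC]_d) i j k l : (A *m delta_mx i j *m B) k l = A k i * B j l.
Proof.
rewrite mxE (bigD1 j) //= big1 ?addr0 => [|m nm].
  rewrite mxE (bigD1 i) //= big1 ?addr0 => [|m nm].
    by rewrite mxE !eqxx mulr1.
  by rewrite mxE (negbTE nm) mulr0.
rewrite mxE big1 ?mul0r // => m' _.
by rewrite mxE (negbTE nm) andbF mulr0.
Qed.

Lemma wreath2_charE a b : wreath2_char (a, b, false) = \tr (rho a) * \tr (rho b).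
Proof.
rewrite cfRepr_full /= trace_lin_mx /mxtrace mulr_suml; apply: eq_bigr => i _.
rewrite mulr_sumr; apply: eq_bigr => j _.
transitivity (((rho a)^T *m delta_mx i j *m rho b) i j); first by [].
by rewrite mul_delta mxE.
Qed.

(** On a tensor square, the trace of a pair of endomorphisms followed by the
    exchange of the factors is the trace of their product. *)
Lemma wreath2_char_swapE a b : wreath2_char (a, b, true) = (-1) ^+ sgn * \tr (rho (a * b)%g).
Proof.
rewrite cfRepr_full /= mxtraceZ trace_lin_mx repr_mxM ?in_setT //; congr (_ * _).
rewrite /mxtrace; apply: eq_bigr => i _.
rewrite [RHS]mxE; apply: eq_bigr => j _.
transitivity (((rho a)^T *m delta_mx i j *m rho b)^T i j); first by [].
by rewrite mxE mul_delta mxE.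
Qed.

End WreathChar.

(** * Schur positivity of the two plethysms *)

Section Graded.
(* Gradings of monoid algebras: Lambda with the weight of p_k equal to k, and
   polynomials in N variables with their degree. *)
Variables (K : monomType) (R : comNzRingType) (w : K -> nat).
Hypotheses (w1 : w 1%M = 0%N) (wM : forall k l, w (k * l)%M = (w k + w l)%N).
Implicit Types f g : {malg R[K]}.

Definition graded n f := forall m, m \in msupp f -> w m = n.

Lemma graded0 n : graded n 0.
Proof. by move=> m; rewrite msupp0. Qed.

Lemma gradedD n f g : graded n f -> graded n g -> graded n (f + g).
Proof. by move=> Hf Hg m /(fsubsetP (msuppD_le _ _)) /fsetUP[/Hf|/Hg]. Qed.

Lemma gradedZ n c f : graded n f -> graded n (c *: f).
Proof. by move=> Hf m /(fsubsetP (msuppZ_le _ _)) /Hf. Qed.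

Lemma gradedU k : graded (w k) << k >>.
Proof. by move=> m /(fsubsetP msuppU_le) /fset1P ->. Qed.

Lemma graded1 : graded 0 1.
Proof. by rewrite -w1; apply: gradedU. Qed.

Lemma gradedM n l f g : graded n f -> graded l g -> graded (n + l) (f * g).
Proof. by move=> Hf Hg m /msuppM_le[k1 [k2 [/Hf <- /Hg <- ->]]]. Qed.

Lemma gradedX n f k : graded n f -> graded (n * k) (f ^+ k).
Proof.
move=> Hf; elim: k => [|k IH]; first by rewrite expr0 muln0; apply: graded1.
by rewrite exprS mulnS; apply: gradedM.
Qed.

End Graded.

Lemma pweight1 : pweight 1%M = 0%N.
Proof. by rewrite /pweight mdom1 big_seq_fset0. Qed.

Lemma pweightM k l : pweight (k * l)%M = (pweight k + pweight l)%N.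
Proof.
have E (m : {cmonom nat}) (d : {fset nat}) : (finsupp m `<=` d)%fset ->
    pweight m = (\sum_(i <- d) m i * i.+1)%N.
  move=> le; rewrite /pweight (big_fset_incl _ le) // => i _.
  by rewrite -cmE_eq0 => /eqP ->.
rewrite (E _ (finsupp k `|` finsupp l)%fset) ?mdomD //.
rewrite (E k _ (fsubsetUl _ (finsupp l))) (E l _ (fsubsetUr (finsupp k) _)).
by rewrite -big_split /=; apply: eq_bigr => i _; rewrite cmM mulnDl.
Qed.

Lemma pweightU i : pweight (ucm i) = i.+1.
Proof. by rewrite /pweight mdomU big_seq_fset1 cmUU mul1n. Qed.

(** If p_k is sent to an element of degree d k, then the homomorphism
    multiplies degrees by d. It is applied to Adams operations with d = k, and
    to the evaluation at the power sums of N variables with d = 1. *)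
Lemma eval_graded (K : conomType) (R : comNzRingType) (w : K -> nat)
    (iota : {rmorphism rat -> R}) (x : nat -> {malg R[K]}) d n f :
  w 1%M = 0%N -> (forall k l, w (k * l)%M = (w k + w l)%N) ->
  (forall k, graded w (d * k.+1)%N (x k.+1)) -> homogeneous n f ->
  graded w (d * n)%N (eval (@malgC K R \o iota) x f).
Proof.
move=> w1 wM Hx Hf.
have Hm (m : {cmonom nat}) : graded w (d * pweight m)%N (eval (@malgC K R \o iota) x << m >>).
  elim/cmonom_ind: m => [|i m IH].
    rewrite pweight1 muln0 (_ : << _ >> = 1) // rmorph1; exact: graded1.
  have -> : eval (@malgC K R \o iota) x << (ucm i * m)%M >>
      = x i.+1 * eval (@malgC K R \o iota) x << m >>.
    rewrite malgUM; apply: etrans (rmorphM (eval (@malgC K R \o iota) x) _ _) _.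
    exact: (congr1 ( *%R^~ _) (eval_psum (@malgC K R \o iota) x (ltn0Sn i))).
  by rewrite pweightM pweightU mulnDr; apply: gradedM.
rewrite (monalgE f) rmorph_sum /= big_seq.
apply: big_ind => [|u v|m mf]; [exact: graded0|exact: gradedD|].
rewrite malgU_scale evalZ /= mul_malgC; apply: gradedZ.
by rewrite -(Hf m mf).
Qed.

Lemma homogeneous_padams n k f : homogeneous n f -> homogeneous (k.+1 * n) (padams k.+1 f).
Proof.
move=> Hf; rewrite /padams psubst_eval.
apply: (eval_graded (iota := idfun) (w := pweight) pweight1 pweightM _ Hf) => l.
have e : pweight (ucm (k.+1 * l.+1).-1) = (k.+1 * l.+1)%N by rewrite pweightU.
by rewrite -[X in graded _ X]e; apply: gradedU.
Qed.

(** The exponents that enter the formula for [mu]f have degree |mu|, and f in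
    N variables has degree n. *)
Lemma graded_schur_coef n f (mu : partition) : homogeneous n f ->
  schur_coef mu f != 0 -> sumn mu = n.
Proof.
move=> Hf; have [N0 H0] := frobenius_schur_coef mu f.
rewrite -(H0 (maxn N0 (size mu))) ?leq_maxl //; set N := maxn _ _.
rewrite frobeniusE => ne; apply/eqP; apply: contraNT ne => ne.
rewrite big1 // => s _; case: ifP => [ok|_]; last by rewrite mulr0.
have Hg : graded mdeg n (in_vars N f).
  have := @eval_graded {cmonom 'I_N} rat mdeg idfun (fun k => \sum_i var rat i ^+ k) 1 n f mdeg1 (@mdegM _).
  rewrite mul1n; apply => // k; rewrite mul1n.
  apply: big_ind => [|u v|i _]; [exact: graded0|exact: gradedD|].
  rewrite -[X in graded _ X]mul1n; apply: gradedX; [exact: mdeg1 | exact: mdegM |].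
  by rewrite -(mdegU i); apply: gradedU.
have [->|nz] := eqVneq ((in_vars N f)@_(expo (shift (nth 0%N mu) s))) 0; first by rewrite mulr0.
have := Hg (expo (shift (nth 0%N mu) s)); rewrite -mcoeff_neq0 nz => /(_ isT).
by rewrite mdeg_expo sum_shift // sum_nth ?leq_maxr // => e; rewrite e eqxx in ne.
Qed.

Section Realize.
Variables (n : nat) (f : Lambda).
Hypotheses (hom_f : homogeneous n f) (pos_f : schur_positive f).

(** A Schur positive f of degree n is the Frobenius characteristic of the
    character of S_n that is the sum of [mu]f times the character of mu. The
    number N of variables must be large enough for all mu in the finite
    support of f. *)
Lemma schur_positive_char : exists x : 'S_n -> rat, exists2 chi : 'CF([set: 'S_n]),
  chi \is a character /\ (forall s, chi s = QtoC (x s)) &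
  f = (n`!%:R)^-1 *: \sum_(s : 'S_n) x s *: cycle_prod psum s.
Proof.
have [N [i0 [sN charN]]] : exists N, exists i0 : 'I_N,
    (forall mu, mu \in schur_supp f -> (size mu <= N)%N) /\
    (forall mu, mu \in schur_supp f -> frobenius_char N (sumn mu) (nth 0%N mu) \is a character).
  suff [N0 H] : exists N0, forall N (i0 : 'I_N), (N0 <= N)%N -> forall mu, mu \in (schur_supp f : seq partition) ->
     (size mu <= N)%N /\ frobenius_char N (sumn mu) (nth 0%N mu) \is a character.
    by exists N0.+1, ord0; split=> mu /(H _ (ord0 : 'I_N0.+1) (leqnSn _)) [].
  elim: (schur_supp f : seq partition) => [|nu r [N1 IH]]; first by exists 0%N.
  have [N2 H2] := frobenius_char_char nu; exists (maxn (size nu) (maxn N1 N2)) => N i0.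
  rewrite !geq_max => /and3P[l1 l2 l3] mu; rewrite in_cons => /predU1P[->|/IH]; last exact.
  by split=> //; apply: H2.
pose x (s : 'S_n) := \sum_(mu <- schur_supp f) schur_coef mu f * frobenius N (nth 0%N mu) (cycle_prod psum s).
pose chi : 'CF([set: 'S_n]) := \sum_(mu <- schur_supp f) QtoC (schur_coef mu f) *: frobenius_char N n (nth 0%N mu).
exists x, chi; first split.
- rewrite /chi big_seq; apply: rpred_sum => mu mf.
  have /natrP[k ->] := pos_f mu; rewrite rmorph_nat scaler_nat rpredMn //.
  have := charN mu mf; rewrite (graded_schur_coef hom_f) // -schur_suppP //.
- move=> s; rewrite /chi /x sum_cfunE rmorph_sum; apply: eq_bigr => mu _.
  by rewrite cfunE (frobenius_charE i0); apply: esym; apply: rmorphM.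
transitivity (\sum_(mu <- schur_supp f) schur_coef mu f *: ((n`!%:R)^-1 *: 
    \sum_(s : 'S_n) frobenius N (nth 0%N mu) (cycle_prod psum s) *: cycle_prod psum s)).
  apply: etrans (schur_sum f) _; apply: eq_big_seq => mu mf; congr (_ *: _).
  rewrite (schur_jacobi_trudi (sN _ mf)) (sum_frobenius i0) //.
  by rewrite sum_nth ?sN // (graded_schur_coef hom_f) // -schur_suppP.
rewrite [in RHS](eq_bigr (fun s : 'S_n => \sum_(mu <- schur_supp f) schur_coef mu f *: 
   (frobenius N (nth 0%N mu) (cycle_prod psum s) *: cycle_prod psum s))); last first.
  by move=> s _; rewrite scaler_suml; apply: eq_bigr => mu _; rewrite scalerA.
rewrite [in RHS]exchange_big [RHS]scaler_sumr; apply: eq_bigr => mu _.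
have scaleAC (V : lmodType rat) (a b : rat) (F : 'S_n -> V) :
  a *: (b *: \sum_s F s) = b *: \sum_s a *: F s by rewrite -scaler_sumr !scalerA mulrC.
exact: scaleAC.
Qed.

(** The plethysm by s_2 or, if sgn is true, by s_(1,1), both written in power
    sums. *)
Definition square_plethysm (sgn : bool) (g : Lambda) : Lambda :=
  2%:R^-1 *: (g * g + (-1) ^+ sgn *: padams 2 g).

(** If V affords a character with Frobenius characteristic f, then the wreath
    product acts on the tensor square of V, with the exchange of factors composed with the
    sign, and square_plethysm sgn f is the average of the trace times the
    power sum of the cycle type. Elements that do not exchange the copies give
    f * f; those that do give p_2 o f, since their traces and their cycle
    types depend only on the product of the two components. *)
Lemma square_plethysm_positive sgn : schur_positive (square_plethysm sgn f).
Proof.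
have [x [chi [char_chi chiE] fE]] := schur_positive_char; move=> mu.
have /char_reprP[[d rho] /= rhoE] := char_chi.
pose a (g : wreath2 'S_n) : rat := let: (s, t, e) := g in
  if e then (-1) ^+ sgn * x (s * t)%g else x s * x t.
apply: (schur_coef_nat (@wreath2_permM n) mu (wreath2_char_char rho sgn) (a := a)).
  move=> [[s t] []] /=.
    by rewrite wreath2_char_swapE -cfRepr_full -rhoE chiE rmorphM rmorph_sign.
  by rewrite wreath2_charE -!cfRepr_full -rhoE !chiE rmorphM.
set F := \sum_(s : 'S_n) x s *: cycle_prod psum s in fE.
pose P : Lambda := \sum_(s : 'S_n) x s *: padams 2 (cycle_prod psum s).
have Pf : padams 2 f = (n`!%:R)^-1 *: P.
  rewrite fE /padams psubstZ; congr (_ *: _).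
  rewrite /F psubst_eval rmorph_sum; apply: eq_bigr => s _ /=.
  by apply: etrans (evalZ _ _ _ _) _; apply: mul_malgC.
rewrite sum_wreath2 card_wreath2 card_Sn.
have scaleM (A : algType rat) (c e : rat) (u v : A) : (c * e) *: (u * v) = (c *: u) * (e *: v).
  by rewrite -scalerAl -scalerAr scalerA.
have E1 : \sum_s \sum_t a (s, t, false) *: cycle_prod psum (wreath2_perm (s, t, false)) = F * F.
  apply: esym; apply: etrans (mulr_suml _ _ _ _) _; apply: eq_bigr => s _.
  apply: etrans (mulr_sumr _ _ _ _) _; apply: eq_bigr => t _.
  by rewrite cycle_prod_wreath2; apply: esym; apply: scaleM.
have E2 : \sum_s \sum_t a (s, t, true) *: cycle_prod psum (wreath2_perm (s, t, true))
   = (-1) ^+ sgn *: (n`!%:R *: P).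
  transitivity (\sum_(s : 'S_n) (-1) ^+ sgn *: P); last first.
    have sum_const (V : lmodType rat) (c : rat) (u : V) :
        \sum_(s : 'S_n) c *: u = c *: (n`!%:R *: u).
      by rewrite sumr_const card_Sn scaler_nat scalerMnr.
    exact: sum_const.
  apply: eq_bigr => s _; rewrite (reindex_inj (mulgI s^-1)%g).
  apply: etrans (esym (scaler_sumr _ _ _ _)); apply: eq_bigr => t _.
  rewrite /a mulKVg cycle_prod_wreath2_swap mulKVg /padams psubst_eval eval_cycle_prod.
  exact: esym (scalerA _ _ _).
apply: etrans (congr1 ( *:%R _) (esym (congr2 +%R E1 E2))).
rewrite /square_plethysm Pf {1 2}fE.
have f0 : (n`!%:R : rat) != 0 by rewrite pnatr_eq0 -lt0n fact_gt0.
have gen (V : lmodType rat) (A B : V) (c e : rat) : c != 0 ->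
    2%:R^-1 *: (c^-1 *: (c^-1 *: A) + e *: (c^-1 *: B))
    = (2%:R * c ^+ 2)^-1 *: (A + e *: (c *: B)).
  move=> c0; rewrite !scalerDr !scalerA; congr (_ *: _ + _ *: _).
    by field.
  by field.
rewrite -scalerAl -scalerAr natrM natrX; exact: gen.
Qed.

End Realize.

(** * Evaluation in one even and two odd variables *)

Section TwoVariables.
Variables (R : comNzRingType).

(** The power sums y_1^k + y_2^k of two variables with e1 = y_1 + y_2 and
    e2 = y_1 y_2; only the elementary functions need to be in R. *)
Definition psum2 (e1 e2 : R) k : R :=
  (iter k (fun p => (p.2, e1 * p.2 - e2 * p.1)) (2%:R, e1)).1.

Lemma psum2SS (e1 e2 : R) k : psum2 e1 e2 k.+2 = e1 * psum2 e1 e2 k.+1 - e2 * psum2 e1 e2 k.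
Proof. by []. Qed.

(** Induction with two steps, as required by second order recursions. *)
Lemma psum2_ind (P : nat -> Prop) : P 0%N -> P 1%N -> (forall k, P k -> P k.+1 -> P k.+2) -> forall k, P k.
Proof. by move=> P0 P1 PS k; suff [] : P k /\ P k.+1 by []; elim: k => // k [? ?]; split=> //; apply: PS. Qed.

Lemma psum2_opp (e1 e2 : R) k : psum2 (- e1) e2 k = (-1) ^+ k * psum2 e1 e2 k.
Proof.
elim/psum2_ind: k => [||k H0 H1]; first by rewrite expr0 mul1r.
  by rewrite expr1 mulN1r.
by rewrite !psum2SS H0 H1 !exprS; ring.
Qed.

(** The squares y_1^2 and y_2^2 have sum e1^2 - 2 e2 and product e2^2. *)
Lemma psum2_double (e1 e2 : R) k :
  psum2 e1 e2 (2 * k) = psum2 (e1 ^+ 2 - 2%:R * e2) (e2 ^+ 2) k.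
Proof.
elim/psum2_ind: k => [||k H0 H1]; first by [].
  by rewrite /psum2 /=; ring.
rewrite psum2SS -H0 -H1 !mulnS !addSn !add0n; set m := (2 * k)%N.
by rewrite !psum2SS; ring.
Qed.

Definition elem2 (e1 e2 : R) : {poly R} := 1 + e1 *: 'X + e2 *: 'X^2.

Lemma coef_elem2 (e1 e2 : R) n : (elem2 e1 e2)`_n =
  match n with 0 => 1 | 1 => e1 | 2 => e2 | _ => 0 end.
Proof.
rewrite /elem2 !coefD !coefZ coef1 coefX coefXn.
by case: n => [|[|[|n]]] /=; ring.
Qed.

(** Two odd variables: their complete functions are the elementary functions
    1, e1, e2. *)
Lemma elem2_newton (e1 e2 : R) :
  newton (fun k => - (-1) ^+ k * psum2 e1 e2 k) (fun n => (elem2 e1 e2)`_n).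
Proof.
split=> [|n]; first exact: coef_elem2.
cbv beta; case: n => [|[|[|n]]]; first by rewrite big_ord0.
- by rewrite big_ord_recl big_ord0 !coef_elem2 /psum2 /=; ring.
- by rewrite 2!big_ord_recl big_ord0 !coef_elem2 /psum2 /=; ring.
rewrite 3!big_ord_recr big1 ?add0r => [|k _].
  rewrite !coef_elem2 /= !subSS !subnn !subSnn.
  have -> : (n.+2 - n = 2)%N by lia.
  by rewrite !psum2SS !exprS; ring.
rewrite coef_elem2; have lk := ltn_ord k.
by case e: (n.+3 - k.+1)%N => [|[|[|m]]]; rewrite ?mulr0 //; move: e => /=; lia.
Qed.

(** The Jacobi-Trudi determinant over a sequence h. With h = 1, e1, e2, 0, ...
    it is the value of a Schur function in two odd variables, which vanishes
    when a part exceeds 2. *)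
Definition jtdet (h : nat -> R) (s : seq nat) : R :=
  \det (\matrix_(i < size s, j < size s)
    (if (i <= nth 0 s i + j)%N then h (nth 0 s i + j - i)%N else 0)).

Lemma jtdet_nil h : jtdet h [::] = 1.
Proof. exact: det_mx00. Qed.

Lemma jtdet_one h a : jtdet h [:: a] = h a.
Proof. by rewrite /jtdet det_mx11 mxE /= addn0 subn0. Qed.

(** The first row is zero except for its first entry. *)
Lemma jtdet_cons h a s : (forall j, h (a + j.+1)%N = 0) -> jtdet h (a :: s) = h a * jtdet h s.
Proof.
move=> ha; rewrite /jtdet (expand_det_row _ ord0) big_ord_recl big1 ?addr0 => [|j _].
  rewrite mxE /= addn0 subn0 /cofactor /= expr0 mul1r; congr (_ * \det _).
  by apply/matrixP => i j; rewrite !mxE !lift0 /= addnS ltnS subSS.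
by rewrite mxE /= subn0 ha mul0r.
Qed.

Variables (e1 e2 : R).
Local Notation q := (fun n => (elem2 e1 e2)`_n).

Lemma jtdet_big a s : (3 <= a)%N -> jtdet q (a :: s) = 0.
Proof.
case: a => [|[|[|a]]] // _; rewrite jtdet_cons => [|j]; last by rewrite coef_elem2.
by rewrite coef_elem2 mul0r.
Qed.

Lemma jtdet_two s : jtdet q (2%N :: s) = e2 * jtdet q s.
Proof. by rewrite jtdet_cons => [|j]; rewrite coef_elem2. Qed.

(* The matrix of the sequence (1^m), with a size free of casts. *)
Let T m := \matrix_(i < m, j < m) (if (i <= j.+1)%N then (elem2 e1 e2)`_(j.+1 - i)%N else 0).

Let jtdet_T m : jtdet q (nseq m 1%N) = \det (T m).
Proof.
have E n : n = m -> \det (\matrix_(i < n, j < n) (if (i <= nth 0 (nseq m 1) i + j)%N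
    then q (nth 0 (nseq m 1) i + j - i)%N else 0)) = \det (T m).
  move=> ->; congr (\det _); apply/matrixP => i j; rewrite !mxE.
  by rewrite nth_nseq ltn_ord add1n.
by apply: E; rewrite size_nseq.
Qed.

(** The matrix is tridiagonal, with e1 on the diagonal, 1 below it and e2
    above it: expand along the first column. *)
Lemma jtdet_ones c : jtdet q (nseq c.+2 1%N) = e1 * jtdet q (nseq c.+1 1%N) - e2 * jtdet q (nseq c 1%N).
Proof.
rewrite !jtdet_T (expand_det_col _ ord0) !big_ord_recl big1 ?addr0 => [|i _]; last first.
  by rewrite mxE /= mul0r.
rewrite ![T c.+2 _ _]mxE !lift0 [ord0 : nat]/= !leqnn !subnn subn0 !coef_elem2 /= mul1r.
rewrite /cofactor /= expr0 expr1 !mul1r mulN1r; congr (e1 * \det _ - _).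
  by apply/matrixP => i j; rewrite !mxE !lift0 !subSS.
rewrite (expand_det_row _ ord0) big_ord_recl big1 ?addr0 => [|j _].
  rewrite !mxE /cofactor /= expr0 mul1r coef_elem2; congr (e2 * \det _).
  by apply/matrixP => i j; rewrite !mxE !lift0.
by rewrite !mxE /= coef_elem2 mul0r.
Qed.

End TwoVariables.

Section SuperEvaluation.
Variables (R : comNzRingType) (iota : {rmorphism rat -> R}).

Section Fixed.
Variables (x e1 e2 : R).

Local Notation q := (fun n => (elem2 e1 e2)`_n).

(** The evaluation of Lambda in one even variable x and two odd variables with
    elementary functions e1, e2. The images of the complete functions have
    the generating series (1 + e1 X + e2 X^2) / (1 - x X). *)
Definition super : Lambda -> R := eval iota (fun k => x ^+ k - (-1) ^+ k * psum2 e1 e2 k).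

HB.instance Definition _ := GRing.RMorphism.copy super
  (eval iota (fun k => x ^+ k - (-1) ^+ k * psum2 e1 e2 k)).

Let h n := super (hsym n).

Let hE n : h n = \sum_(i < n.+1) (elem2 e1 e2)`_i * x ^+ (n - i).
Proof.
apply: (eval_hsym iota (a := conv q (fun n => x ^+ n))).
apply: eq_newton (newton_conv (elem2_newton e1 e2) (newton_geom x)) => // k.
by rewrite mulNr addrC.
Qed.

Let h_step n : h n.+1 - x * h n = (elem2 e1 e2)`_n.+1.
Proof.
rewrite !hE big_ord_recr /= subnn expr0 mulr1 mulr_sumr addrC.
rewrite -addrA -sumrB big1 ?addr0 // => i _.
have li := ltn_ord i; rewrite -/(_ - _) subSn // exprS; ring.
Qed.

(** The numerator of the generating series vanishes in degrees above 2, so that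
    the values form a geometric progression. *)
Lemma super_hsym n : h n.+2 = x ^+ n * (x ^+ 2 + e1 * x + e2).
Proof.
elim: n => [|n IH].
  by rewrite hE 3!big_ord_recl big_ord0 !coef_elem2 /bump /= expr0 mul1r; ring.
rewrite -[LHS](subrK (x * h n.+2)) h_step coef_elem2 add0r IH.
by rewrite mulrA -exprS.
Qed.

Lemma superZ c f : super (c *: f) = iota c * super f.
Proof. exact: evalZ. Qed.

(** Subtracting from each column x times the previous one replaces h_k by the
    coefficient q_k of the numerator, except in the first column. As a >= 2,
    the first row becomes zero beyond its first entry h_a, and the remaining
    minor is that of two odd variables for the partition s. *)
Lemma super_schur_cons a s : (2 <= a)%N ->
  super (schur (a :: s)) = x ^+ (a - 2) * (x ^+ 2 + e1 * x + e2) * jtdet q s.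
Proof.
case: a => [|[|a]] // _; set la := a.+2 :: s; set N := size la.
pose m (i j : 'I_N) := if (i <= nth 0 la i + j)%N then h (nth 0%N la i + j - i)%N else 0.
(* C performs the column operations. *)
pose C : 'M[R]_N := \matrix_(i, j) ((i == j)%:R - x *+ (i.+1 == j :> nat)).
pose M := \matrix_(i, j) m i j.
have dC : \det C = 1.
  rewrite -det_tr det_trig; last first.
    apply/is_trig_mxP => i j lij; rewrite !mxE -val_eqE /= gtn_eqF //.
    by rewrite (_ : (j.+1 == i :> nat) = false) ?mulr0n ?subr0 //; lia.
  by rewrite big1 // => i _; rewrite !mxE eqxx (_ : (i.+1 == i :> nat) = false) ?mulr0n ?subr0 //; lia.
have MC0 i : (M *m C) i ord0 = m i ord0.
  rewrite mxE (bigD1 ord0) // big1 ?addr0 => [|j nj]; rewrite !mxE.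
    by rewrite eqxx mulr0n subr0 mulr1; apply: addr0.
  by rewrite (negbTE nj) mulr0n subr0 mulr0.
have MCS i (j : 'I_(size s)) : (M *m C) i (lift ord0 j) = 
    if (i <= nth 0 la i + j.+1)%N then (elem2 e1 e2)`_(nth 0%N la i + j.+1 - i)%N else 0.
  pose j0 := widen_ord (leqnSn (size s)) j.
  have n0 : j0 != lift ord0 j by rewrite -val_eqE /= /bump /=; lia.
  rewrite mxE (bigD1 (lift ord0 j)) // (bigD1 j0) // big1 ?addr0 => [|k /andP[n1 n2]]; last first.
    rewrite !mxE (negbTE n1) (_ : (k.+1 == lift ord0 j :> nat) = false) ?mulr0n ?subr0 ?mulr0 //.
    by apply: contraNF n2 => /eqP; rewrite lift0 => -[e]; apply/eqP/ord_inj.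
  rewrite [LHS]/= addr0 !mxE eqxx -[j0 == _]val_eqE /= /bump /= add1n eqxx.
  have -> : (j.+2 == j.+1) = false by apply: gtn_eqF.
  have -> : (nat_of_ord j == j.+1) = false by apply: ltn_eqF.
  have fin (y z : R) : y * (1 - x *+ false) + z * (false%:R - x *+ true) = y - x * z.
    by rewrite /= mulr0n subr0 mulr1 sub0r mulr1n mulrN [z * x]mulrC.
  apply: etrans (fin _ _) _.
  rewrite /m lift0 /=; set l := nth 0%N la i.
  rewrite addnS; have [le|lt] := leqP i (l + j).
    by rewrite leqW // subSn // -h_step.
  rewrite mulr0 subr0; case: leqP => // le.
  have -> : ((l + j).+1 - i = 0)%N by lia.
  by rewrite hE big_ord_recl big_ord0 addr0 coef_elem2 expr0 mulr1.
have -> : super (schur la) = \det M.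
  rewrite /schur -det_map_mx; congr (\det _); apply/matrixP => i j; rewrite !mxE /m.
  by case: ifP => // _; rewrite rmorph0.
rewrite -[LHS]mulr1 -dC -det_mulmx (expand_det_row _ ord0) big_ord_recl big1 ?addr0 => [|j _]; last first.
  by rewrite MCS /= subn0 addSn coef_elem2 addnS mul0r.
rewrite MC0 /m /= addn0 subn0 super_hsym !subSS subn0; congr (_ * _).
rewrite /cofactor /= expr0 mul1r; congr (\det _); apply/matrixP => i j.
transitivity ((M *m C) (lift ord0 i) (lift ord0 j)); first by rewrite [LHS]mxE [LHS]mxE.
by rewrite MCS mxE lift0 /= addnS ltnS subSS.
Qed.

End Fixed.

Lemma super_schur0 e1 e2 (la : partition) : super 0 e1 e2 (schur la) = jtdet (fun n => (elem2 e1 e2)`_n) la.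
Proof.
rewrite /schur -det_map_mx; congr (\det _); apply/matrixP => i j; rewrite !mxE.
case: ifP => // _; last by rewrite rmorph0.
apply: (eval_hsym iota (a := fun n => (elem2 e1 e2)`_n)).
apply: eq_newton (elem2_newton e1 e2) => // k.
by rewrite expr0n /= sub0r mulNr.
Qed.

(** The squares of the variables: an odd variable y contributes
    -(-1)^k y^k to p_k, hence -y^(2k) = -(-1)^k (-y^2)^k to p_2k, so that y is
    replaced by -y^2. *)
Lemma super_padams2 x e1 e2 f : 
  super x e1 e2 (padams 2 f) = super (x ^+ 2) (2%:R * e2 - e1 ^+ 2) (e2 ^+ 2) f.
Proof.
rewrite /super eval_padams //; apply: eval_ext => k.
rewrite psum2_double -(opprB (e1 ^+ 2)) psum2_opp signrMK.
by rewrite exprM [(-1) ^+ (2 * _)]exprM sqrrN !expr1n mul1r.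
Qed.

End SuperEvaluation.

Section Chebyshev.
Variable R : comNzRingType.

(** Chebyshev polynomials of the second kind, normalised to be monic in u: for
    y_1 + y_2 = t u and y_1 y_2 = t^2, t^k cheb u k is the complete function of
    degree k in y_1, y_2. *)
Definition cheb (u : R) k : R := (iter k (fun p => (p.2, u * p.2 - p.1)) (1, u)).1.

Lemma chebSS u k : cheb u k.+2 = u * cheb u k.+1 - cheb u k.
Proof. by []. Qed.

(** In the parametrisation e1 = t u, e2 = t^2, each part 2 contributes t^2 and
    the parts 1 contribute a Chebyshev polynomial. *)
Lemma jtdet_hook (t u : R) b c :
  jtdet (fun n => (elem2 (t * u) (t ^+ 2))`_n) (nseq b 2 ++ nseq c 1%N)
  = t ^+ (2 * b) * (t ^+ c * cheb u c).
Proof.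
elim: b => [|b IH].
  rewrite muln0 expr0 mul1r /=; elim/psum2_ind: c => [||c H0 H1].
  - by rewrite [nseq _ _]/= jtdet_nil expr0 mul1r.
  - by rewrite [nseq _ _]/= jtdet_one coef_elem2 expr1.
  by rewrite jtdet_ones H0 H1 chebSS !exprS; ring.
by rewrite /= jtdet_two IH mulnS exprD mulrA.
Qed.

End Chebyshev.

(** * The evaluation of a flip-symmetric function *)

Lemma two_ones (s : seq nat) : sorted geq s -> 0%N \notin s -> (head 0%N s <= 2)%N ->
  exists b c, s = nseq b 2%N ++ nseq c 1%N.
Proof.
elim: s => [|a s IH] /=; first by exists 0%N, 0%N.
move=> sas; rewrite inE negb_or => /andP[a0 s0] a2.
have ss : sorted geq s by apply: path_sorted sas.
have hs : (head 0%N s <= a)%N by case: s sas {IH s0 ss} => //= b s /andP[].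
have [b [c e]] := IH ss s0 (leq_trans hs a2).
case: a a0 a2 hs sas {IH} => [|[|[|a]]] // _ _ hs sas; last by exists b.+1, c; rewrite e.
exists 0%N, c.+1; case: b e hs => [->//|b ->] /=.
by [].
Qed.

(** The last case gathers the partitions that are not hook+column, those with
    a second part of size at least 3. *)
Lemma partition_cases (la : partition) :
  [\/ la = [::] :> seq nat, (exists b c, la = hookcol_seq 1 b c :> seq nat),
      (exists a b c, la = hookcol_seq a.+2 b c :> seq nat) |
      (exists a d s, la = [:: a.+2, d.+3 & s] :> seq nat)].
Proof.
case: la => -[|a s] /= P; first by constructor 1.
have /andP[sas] := P; rewrite inE negb_or => /andP[a0 s0].
have ss : sorted geq s by apply: path_sorted sas.
have [h2|h3] := leqP (head 0%N s) 2.
  have [b [c ->]] := two_ones ss s0 h2.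
  case: a {P sas} a0 => [|[|a]] // _; first by constructor 2; exists b, c.
  by constructor 3; exists a, b, c.
constructor 4; case: s sas h3 {P ss s0} => [|d s] //= /andP[da _] h3.
case: d da h3 => [|[|[|d]]] //= da _; case: a a0 da => [|[|a]] // _ _.
by exists a, d, s.
Qed.

Lemma hookcol1 (la : partition) b c : la = hookcol_seq 1 b c :> seq nat -> la = nseq c.+1 1%N :> seq nat.
Proof.
move=> e; have /andP[] := valP la; rewrite [\val la]e.
by case: b e => [|b] // _ /=.
Qed.

Lemma sumn_hookcol a b c : sumn (hookcol_seq a b c) = (a + (2 * b + c))%N.
Proof. by rewrite /= sumn_cat !sumn_nseq mul1n. Qed.

(** Coefficients indexed by arbitrary sequences, zero when the sequence is not
    a partition, so that sums over exponents need no side condition. *)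
Definition seq_coef f (s : seq nat) : rat :=
  oapp (fun mu : partition => schur_coef mu f) 0 (insub s).

Lemma seq_coefE f (mu : partition) : seq_coef f mu = schur_coef mu f.
Proof. by rewrite /seq_coef valK. Qed.

Lemma seq_coef_neq0 f s : seq_coef f s != 0 -> exists mu : partition, mu = s :> seq nat.
Proof. by rewrite /seq_coef; case: insubP => [mu _ <- _|_]; [exists mu | rewrite eqxx]. Qed.

Lemma jtdet_ones0 (R : comNzRingType) (y : R) c :
  jtdet (fun n => (elem2 y 0)`_n) (nseq c 1%N) = y ^+ c.
Proof.
elim/psum2_ind: c => [||c H0 H1]; first by rewrite [nseq _ _]/= jtdet_nil expr0.
  by rewrite [nseq _ _]/= jtdet_one coef_elem2 expr1.
by rewrite jtdet_ones H1 mul0r subr0 -exprS.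
Qed.

Lemma sum_triple (R : nmodType) M (G : 'I_M -> 'I_M -> 'I_M -> R) :
  \sum_(i : 'I_M * ('I_M * 'I_M)) G i.1 i.2.1 i.2.2 = \sum_(a < M) \sum_(b < M) \sum_(c < M) G a b c.
Proof.
rewrite -(pair_bigA _ (fun a (p : 'I_M * 'I_M) => G a p.1 p.2)) /=.
by apply: eq_bigr => a _; rewrite -(pair_bigA _ (fun b c => G a b c)).
Qed.

Section Super.
Variables (R : comNzRingType) (iota : {rmorphism rat -> R}).

(** T i is the value of s_mu at the index i of mu; partitions without index
    have value 0. *)
Lemma super_sum x e1 e2 (I : finType) (sigma : I -> seq nat) (T : I -> R) f :
  (forall mu : partition, schur_coef mu f != 0 ->
     super iota x e1 e2 (schur mu) = \sum_(i | sigma i == mu) T i) ->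
  super iota x e1 e2 f = \sum_i iota (seq_coef f (sigma i)) * T i.
Proof.
move=> H; rewrite {1}(schur_sum f) rmorph_sum /=.
transitivity (\sum_(mu <- schur_supp f) \sum_i if sigma i == mu then iota (schur_coef mu f) * T i else 0).
  apply: eq_big_seq => mu; rewrite schur_suppP => /H e.
  by rewrite superZ e -big_mkcond mulr_sumr.
rewrite exchange_big; apply: eq_bigr => i _ /=.
rewrite /seq_coef; case: insubP => [mu _ e|nP] /=; last first.
  rewrite rmorph0 mul0r big1 // => mu _; case: eqP => // e.
  by rewrite e (valP mu) in nP.
have [mf|mf] := boolP (mu \in schur_supp f); last first.
  have /eqP -> : schur_coef mu f == 0 by rewrite -[_ == _]negbK -schur_suppP.
  rewrite rmorph0 mul0r big_seq big1 // => nu nuf; case: eqP => // e'.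
  by rewrite -e in e'; rewrite -(val_inj e') (negbTE mf) in nuf.
rewrite (big_fsetD1 mu) //= -e eqxx big_seq big1 ?addr0 // => nu /fsetD1P[nn _].
by case: eqP => // /val_inj e'; rewrite e' eqxx in nn.
Qed.

(** (x + y_1) (x + y_2) for y_1 + y_2 = t u and y_1 y_2 = t^2. It is symmetric
    in x and t. *)
Definition quad (x t u : R) := x ^+ 2 + t * u * x + t ^+ 2.

Lemma super_hookcol x t u (mu : partition) a b c : mu = hookcol_seq a.+2 b c :> seq nat ->
  super iota x (t * u) (t ^+ 2) (schur mu) = quad x t u * (x ^+ a * (t ^+ (2 * b + c) * cheb u c)).
Proof.
move=> ->; rewrite super_schur_cons // jtdet_hook !subSS subn0 /quad exprD; ring.
Qed.

Lemma super_big x e1 e2 (mu : partition) a d s : mu = [:: a.+2, d.+3 & s] :> seq nat ->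
  super iota x e1 e2 (schur mu) = 0.
Proof. by move=> ->; rewrite super_schur_cons // jtdet_big // mulr0. Qed.

Variables (n : nat) (f : Lambda).
Hypotheses (n0 : (0 < n)%N) (hom : forall mu : partition, schur_coef mu f != 0 -> sumn mu = n).

(** The column (1^n) is the hook+column partition with first part below 2, to
    which super_schur_cons does not apply; the evaluation in a single odd
    variable y isolates its coefficient. *)
Lemma super_columns y :
  super iota 0 y 0 f = iota (seq_coef f (nseq n 1%N)) * y ^+ n.
Proof.
rewrite (super_sum (I := unit) (sigma := fun=> nseq n 1%N) (T := fun=> y ^+ n)).
  by rewrite (big_pred1 tt) // => -[].
move=> mu /hom smu; rewrite super_schur0.
case: (partition_cases mu) => [e|[b [c /hookcol1 e]]|[a [b [c e]]]|[a [d [s e]]]].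
- by move: n0; rewrite -smu e.
- have -> : n = c.+1 by rewrite -smu e sumn_nseq mul1n.
  rewrite (big_pred1 tt) => [|[]]; last by rewrite e !eqxx.
  by rewrite e jtdet_ones0.
- rewrite big_pred0 => [|_]; last by rewrite e; case: (n) => [|[|m]].
  rewrite e /hookcol_seq; case: a {e} => [|a]; last by rewrite jtdet_big.
  by rewrite jtdet_two mul0r.
rewrite big_pred0 => [|_]; last by rewrite e; case: (n) => [|[|m]].
rewrite e; case: a {e} => [|a]; last by rewrite jtdet_big.
by rewrite jtdet_two mul0r.
Qed.

Hypothesis no_columns : seq_coef f (nseq n 1%N) = 0.

Lemma supp_cases (mu : partition) : schur_coef mu f != 0 ->
  (exists a b c, mu = hookcol_seq a.+2 b c :> seq nat) \/
  (exists a d s, mu = [:: a.+2, d.+3 & s] :> seq nat).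
Proof.
move=> muf; have smu := hom muf.
case: (partition_cases mu) => [e|[b [c /hookcol1 e]]|?|?]; [| |by left|by right].
  by move: n0; rewrite -smu e.
have en : n = c.+1 by rewrite -smu e sumn_nseq mul1n.
by rewrite -seq_coefE e -en no_columns eqxx in muf.
Qed.

(** The partitions outside the hook+column shape evaluate to 0; M bounds all
    exponents. *)
Lemma super_hook_sum x t u M : (n < M)%N ->
  super iota x (t * u) (t ^+ 2) f = quad x t u *
    \sum_(a < M) \sum_(b < M) \sum_(c < M) iota (seq_coef f (hookcol_seq a.+2 b c)) *
       (x ^+ a * (t ^+ (2 * b + c) * cheb u c)).
Proof.
move=> nM; pose I := ('I_M * ('I_M * 'I_M))%type.
pose T (i : I) := quad x t u * (x ^+ i.1 * (t ^+ (2 * i.2.1 + i.2.2) * cheb u i.2.2)).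
rewrite (super_sum (I := I) (sigma := fun i => hookcol_seq i.1.+2 i.2.1 i.2.2) (T := T)); last first.
  move=> mu muf; have smu := hom muf.
  case: (supp_cases muf) => [[a [b [c e]]]|[a [d [s e]]]]; last first.
    rewrite (super_big _ _ _ e) big_pred0 // => i; rewrite e; apply/eqP => -[_].
    by case: (nat_of_ord i.2.1) (nat_of_ord i.2.2) => [|b] [|c].
  rewrite (super_hookcol _ _ _ e); move: smu; rewrite e sumn_hookcol => smu.
  have la : (a < M)%N by lia.
  have lb : (b < M)%N by lia.
  have lc : (c < M)%N by lia.
  rewrite (big_pred1 (Ordinal la, (Ordinal lb, Ordinal lc))) // => -[i [j k]] /=.
  apply/eqP/eqP => [/hookcol_seq_inj[[ei] ej ek]|[-> -> ->] //].
  by congr (_, (_, _)); apply: ord_inj.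
apply: etrans (sum_triple (fun a b c : 'I_M => iota (seq_coef f (hookcol_seq a.+2 b c)) * T (a, (b, c)))) _.
rewrite mulr_sumr; apply: eq_bigr => a _; rewrite mulr_sumr; apply: eq_bigr => b _.
rewrite mulr_sumr; apply: eq_bigr => c _; exact: mulrCA.
Qed.

Variable r : nat.
Hypotheses (r2 : (2 <= r)%N) (flip_f : flip_symmetric r f).

(** The evaluation of f after division by x^(r-2) quad x t u. For the partition
    (r + 2 d + c, 2^b, 1^c) the exponents of x and t are 2 d + c and 2 b + c,
    so that the flip, which exchanges b and d, exchanges x and t. *)
Definition flip_sum M x t u :=
  \sum_(c < M) \sum_(b < M) \sum_(d < M) iota (seq_coef f (hookcol_seq (r + 2 * d + c) b c)) *
    ((x * t) ^+ c * (x ^+ (2 * d) * t ^+ (2 * b)) * cheb u c).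

Lemma flip_coef b c d : seq_coef f (hookcol_seq (r + 2 * d + c) b c)
  = seq_coef f (hookcol_seq (r + 2 * b + c) d c).
Proof.
have gen b' d' : seq_coef f (hookcol_seq (r + 2 * d' + c) b' c) != 0 ->
    seq_coef f (hookcol_seq (r + 2 * d' + c) b' c) = seq_coef f (hookcol_seq (r + 2 * b' + c) d' c).
  move=> nz; have [mu e] := seq_coef_neq0 nz; move: nz; rewrite -e seq_coefE => nz.
  have [|nu [b1 [c1 [d1 [e1 e2]]]] ->] := flip_f _ nz; first by exists (r + 2 * d' + c)%N, b', c.
  have [ea eb ec] := hookcol_seq_inj (etrans (esym e) e1).
  rewrite -seq_coefE e2 -eb -ec; congr (seq_coef f (hookcol_seq _ _ _)).
  by move: ea; rewrite -ec; lia.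
have [e1|/gen //] := eqVneq (seq_coef f (hookcol_seq (r + 2 * d + c) b c)) 0.
have [e2|/gen] := eqVneq (seq_coef f (hookcol_seq (r + 2 * b + c) d c)) 0; first by rewrite e1 e2.
by move=> ->.
Qed.

Lemma flip_sumC M x t u : flip_sum M x t u = flip_sum M t x u.
Proof.
apply: eq_bigr => c _; rewrite exchange_big; apply: eq_bigr => d _; apply: eq_bigr => b _.
by rewrite flip_coef [x * t]mulrC [x ^+ _ * _]mulrC.
Qed.

(** In each term, the exponents of x and t have the same parity. *)
Lemma flip_sumN M x t u : flip_sum M (- x) (- t) u = flip_sum M x t u.
Proof.
apply: eq_bigr => c _; apply: eq_bigr => d _; apply: eq_bigr => b _.
by rewrite mulrNN !exprM !sqrrN.
Qed.

(** On the support of f the first part is r + 2 d + c, by the first condition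
    of flip symmetry. *)
Lemma super_flip_symmetric x t u M : (n < M)%N ->
  super iota x (t * u) (t ^+ 2) f = x ^+ (r - 2) * quad x t u * flip_sum M x t u.
Proof.
move=> nM; pose I := ('I_M * ('I_M * 'I_M))%type.
pose T (i : I) := x ^+ (r - 2) * quad x t u *
   ((x * t) ^+ i.1 * (x ^+ (2 * i.2.2) * t ^+ (2 * i.2.1)) * cheb u i.1).
rewrite (super_sum (I := I) (sigma := fun i => hookcol_seq (r + 2 * i.2.2 + i.1) i.2.1 i.1) (T := T)); last first.
  move=> mu muf; have smu := hom muf.
  case: (supp_cases muf) => [[a [b [c e]]]|[a [d [s e]]]]; last first.
    rewrite (super_big _ _ _ e) big_pred0 // => i; rewrite e; apply/eqP => -[_].
    by case: (nat_of_ord i.2.1) (nat_of_ord i.1) => [|b] [|c].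
  have [|nu [b1 [c1 [d [e1 _]]]] _] := flip_f _ muf; first by exists a.+2, b, c.
  have [ea eb ec] := hookcol_seq_inj (etrans (esym e) e1).
  rewrite (super_hookcol _ _ _ e); move: smu; rewrite e sumn_hookcol => smu.
  have ld : (d < M)%N by lia.
  have lb : (b < M)%N by lia.
  have lc : (c < M)%N by lia.
  rewrite (big_pred1 (Ordinal lc, (Ordinal lb, Ordinal ld))) => [|[k [j i]]] /=; last first.
    rewrite ea -ec; apply/eqP/eqP => [/hookcol_seq_inj[ei ej ek]|[-> -> ->] //].
    by congr (_, (_, _)); apply: ord_inj => //=; move: ei; rewrite ek; lia.
  have -> : a = (r - 2 + 2 * d + c)%N by lia.
  by rewrite /T /= exprMn !exprD; ring.
apply: etrans (sum_triple (fun c b d : 'I_M => iota (seq_coef f (hookcol_seq (r + 2 * d + c) b c)) * T (c, (b, d)))) _.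
rewrite mulr_sumr; apply: eq_bigr => c _; rewrite mulr_sumr; apply: eq_bigr => b _.
rewrite mulr_sumr; apply: eq_bigr => d _; exact: mulrCA.
Qed.

End Super.

(** * Recovering flip symmetry from the evaluation *)

Lemma cheb0 (R : comNzRingType) (u : R) : cheb u 0 = 1.
Proof. by []. Qed.

Lemma cheb1 (R : comNzRingType) (u : R) : cheb u 1 = u.
Proof. by []. Qed.

Lemma neq0_sum (V : nmodType) (I : finType) (F : I -> V) : \sum_i F i != 0 -> exists i, F i != 0.
Proof.
move=> nz; have [/existsP//|/existsPn h] := boolP [exists i, F i != 0].
by rewrite big1 ?eqxx // in nz => i _; apply/eqP; have := h i; rewrite negbK.
Qed.

Lemma cheb_rmorph (R S : comNzRingType) (g : {rmorphism R -> S}) u k :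
  g (cheb u k) = cheb (g u) k.
Proof.
elim/psum2_ind: k => [||k H0 H1]; [exact: rmorph1|by []|].
by rewrite !chebSS rmorphB rmorphM H0 H1.
Qed.

Lemma cheb_monic k : (cheb ('X : {poly rat}) k)`_k = 1 /\
  forall l, (k < l)%N -> (cheb ('X : {poly rat}) k)`_l = 0.
Proof.
elim/psum2_ind: k => [||k [_ H0] [H1 H1']].
- by split=> [|l l0]; rewrite /cheb /= coef1 // gtn_eqF.
- by split=> [|l l0]; rewrite /cheb /= coefX // gtn_eqF.
split=> [|l lk]; rewrite chebSS coefB coefXM /=.
  by rewrite H1 H0 ?subr0.
by case: l lk => // l lk; rewrite /= H1' // H0 ?subr0 //; lia.
Qed.

(** The Chebyshev polynomials have distinct degrees and are monic. *)
Lemma cheb_free M (k l : 'I_M -> rat) :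
  \sum_c k c *: cheb ('X : {poly rat}) c = \sum_c l c *: cheb 'X c -> k =1 l.
Proof.
suff H N (m : 'I_N -> rat) : \sum_c m c *: cheb ('X : {poly rat}) c = 0 -> forall c, m c = 0.
  move=> e c; apply/eqP; rewrite -subr_eq0; apply/eqP.
  apply: (H _ (fun c => k c - l c)); rewrite -[RHS](subrr (\sum_c l c *: cheb 'X c)) -{1}e -sumrB.
  by apply: eq_bigr => i _; rewrite scalerBl.
elim: N m => [|N IH] m; first by move=> _ [].
rewrite big_ord_recr /= => e; have mN : m ord_max = 0.
  have := congr1 (fun p : {poly rat} => p`_N) e.
  rewrite coefD coef_sum big1 ?add0r => [|c _]; last first.
    by rewrite coefZ (cheb_monic c).2 ?mulr0.
  by rewrite coefZ (cheb_monic N).1 mulr1 coef0.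
move: e; rewrite mN scale0r addr0 => /IH H c.
case: (unliftP ord_max c) => [c'|] -> //; rewrite -(H c'); congr m.
by apply: ord_inj; rewrite lift_max.
Qed.

Section FlipCriterion.
(* Polynomials in x over polynomials in t over polynomials in u. *)
Notation B := {poly {poly {poly rat}}}.

Definition cst : rat -> B := polyC \o polyC \o polyC.
HB.instance Definition _ := GRing.RMorphism.copy cst
  (@polyC {poly {poly rat}} \o @polyC {poly rat} \o @polyC rat).

Definition vx : B := 'X.
Definition vt : B := ('X : {poly {poly rat}})%:P.
Definition vu : B := (('X : {poly rat})%:P : {poly {poly rat}})%:P.

(** The coefficient of x^i t^j, a polynomial in u. *)
Definition cf i j (p : B) : {poly rat} := (p`_i)`_j.

Lemma cf_sum i j I (s : seq I) (P : pred I) (F : I -> B) :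
  cf i j (\sum_(k <- s | P k) F k) = \sum_(k <- s | P k) cf i j (F k).
Proof. by rewrite /cf !coef_sum. Qed.

Lemma cfD i j (p q : B) : cf i j (p + q) = cf i j p + cf i j q.
Proof. by rewrite /cf !coefD. Qed.

Lemma cf_term i j i' j' k c : cf i j (cst c * (vx ^+ i' * (vt ^+ j' * cheb vu k)))
  = c *: cheb 'X k *+ ((i' == i) && (j' == j)).
Proof.
have -> : cheb vu k = ((cheb 'X k)%:P)%:P.
  exact: esym (cheb_rmorph (@polyC {poly {poly rat}} \o @polyC {poly rat}) 'X k).
have -> : vt ^+ j' = ('X^j')%:P by rewrite /vt -rmorphXn.
rewrite /cf /cst /= /vx mulrCA -!rmorphM /= mulrC coefCM coefXn.
rewrite eq_sym; case: (i' == i) => /=; last by rewrite mulr0 coef0 mulr0n.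
rewrite mulr1 mulrCA -rmorphM /= mulrC coefCM coefXn eq_sym.
by case: (j' == j); rewrite /= ?mulr1 ?mulr0 // mul_polyC.
Qed.

Lemma quad_neq0 : quad vx vt vu != 0.
Proof.
have e : quad vx vt vu = cst 1 * (vx ^+ 2 * (vt ^+ 0 * cheb vu 0))
    + cst 1 * (vx ^+ 1 * (vt ^+ 1 * cheb vu 1)) + cst 1 * (vx ^+ 0 * (vt ^+ 2 * cheb vu 0)).
  have c1 : cst 1 = 1 by apply: rmorph1.
  by rewrite /quad c1 cheb0 cheb1; ring.
have v : cf 2 0 (quad vx vt vu) = 1.
  rewrite e; apply: etrans (cfD _ _ _ _) _.
  apply: etrans (congr2 +%R (etrans (cfD _ _ _ _) (congr2 +%R
    (cf_term 2 0 2 0 0 1) (cf_term 2 0 1 1 1 1))) (cf_term 2 0 0 2 0 1)) _.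
  rewrite cheb0 cheb1 !scale1r.
  have t1 (b1 b2 b3 : {poly rat}) : b1 *+ true + b2 *+ false + b3 *+ false = b1.
    by rewrite mulr1n !mulr0n !addr0.
  exact: t1.
apply/eqP => q0; have := oner_neq0 {poly rat}.
by rewrite -v q0 /cf !coef0 eqxx.
Qed.

Variables (n r : nat) (f : Lambda).
Hypotheses (n0 : (0 < n)%N) (hom : forall mu : partition, schur_coef mu f != 0 -> sumn mu = n).
Hypothesis no_columns : seq_coef f (nseq n 1%N) = 0.
Hypothesis r2 : (2 <= r)%N.
Variable G : B -> B -> B -> B.
Hypothesis G_sym : forall x t u, G x t u = G t x u.
Hypothesis superG : forall x t u, super cst x (t * u) (t ^+ 2) f = x ^+ (r - 2) * quad x t u * G x t u.

Let C a b c := seq_coef f (hookcol_seq a.+2 b c).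
Let M := n.+1.

(* The evaluation of f divided by quad, over all hook+column partitions. *)
Let H x t := \sum_(a < M) \sum_(b < M) \sum_(c < M) cst (C a b c) * (x ^+ a * (t ^+ (2 * b + c) * cheb vu c)).

Let H_xt : H vx vt = vx ^+ (r - 2) * G vx vt vu.
Proof.
apply: (mulfI quad_neq0); rewrite -(super_hook_sum cst n0 hom no_columns _ _ _ (ltnSn n)) superG.
ring.
Qed.

Let quadC x t u : quad x t u = quad t x u :> B.
Proof. rewrite /quad; ring. Qed.

Let H_tx : H vt vx = vt ^+ (r - 2) * G vx vt vu.
Proof.
apply: (mulfI quad_neq0); rewrite quadC -(super_hook_sum cst n0 hom no_columns _ _ _ (ltnSn n)) superG.
rewrite (G_sym vt); ring.
Qed.

Let cf_shift i j (F : 'I_M -> 'I_M -> 'I_M -> B) (p q : 'I_M -> 'I_M -> 'I_M -> nat) :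
  (forall a b c, F a b c = cst (C a b c) * (vx ^+ p a b c * (vt ^+ q a b c * cheb vu c))) ->
  cf i j (\sum_a \sum_b \sum_c F a b c) = \sum_(c < M)
    (\sum_(a < M) \sum_(b < M) C a b c *+ ((p a b c == i) && (q a b c == j))) *: cheb 'X c.
Proof.
move=> FE; rewrite cf_sum.
transitivity (\sum_(a < M) \sum_(c < M) \sum_(b < M)
   (C a b c *+ ((p a b c == i) && (q a b c == j))) *: cheb ('X : {poly rat}) c).
  apply: eq_bigr => a _; rewrite cf_sum [RHS]exchange_big; apply: eq_bigr => b _.
  by rewrite cf_sum; apply: eq_bigr => c _; rewrite FE cf_term scalerMnl.
rewrite exchange_big; apply: eq_bigr => c _; rewrite scaler_suml; apply: eq_bigr => a _.
by rewrite scaler_suml.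
Qed.

(* Comparison of coefficients, including those of the Chebyshev polynomials, in
   t^(r-2) H x t = x^(r-2) H t x. For given i, j and c,
   each side has at most one non-zero term. *)
Let key i j (c : 'I_M) :
  \sum_(a < M) \sum_(b < M) C a b c *+ ((a == i :> nat) && (r - 2 + (2 * b + c) == j)%N)
  = \sum_(a < M) \sum_(b < M) C a b c *+ ((r - 2 + (2 * b + c) == i)%N && (a == j :> nat)).
Proof.
move: c; apply: cheb_free.
rewrite -(@cf_shift i j (fun a b c => vt ^+ (r - 2) * (cst (C a b c) * (vx ^+ a * (vt ^+ (2 * b + c) * cheb vu c))))
  (fun a b c => a) (fun a b c => r - 2 + (2 * b + c))%N); last first.
  by move=> a b c; rewrite (exprD _ (r - 2)%N); ring.
rewrite -(@cf_shift i j (fun a b c => vx ^+ (r - 2) * (cst (C a b c) * (vt ^+ a * (vx ^+ (2 * b + c) * cheb vu c))))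
  (fun a b c => r - 2 + (2 * b + c))%N (fun a b c => a)); last first.
  by move=> a b c; rewrite (exprD _ (r - 2)%N); ring.
congr (cf i j _).
transitivity (vt ^+ (r - 2) * H vx vt).
  rewrite mulr_sumr; apply: eq_bigr => a _; rewrite mulr_sumr; apply: eq_bigr => b _.
  by rewrite mulr_sumr.
transitivity (vx ^+ (r - 2) * H vt vx); first by rewrite H_xt H_tx; ring.
rewrite mulr_sumr; apply: eq_bigr => a _; rewrite mulr_sumr; apply: eq_bigr => b _.
by rewrite mulr_sumr.
Qed.

(** The converse of the previous evaluation. With H = x^(r-2) G and G symmetric
    in x and t, t^(r-2) H(x, t) = x^(r-2) H(t, x). For a partition
    (a+2, 2^b, 1^c) in the support, the term x^a t^(r-2+2b+c) of the left side
    must occur on the right side, where it comes from (i+2, 2^j, 1^c) with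
    i = r-2+2b+c and a = r-2+2j+c: the flip is defined, and the coefficients
    agree. *)
Lemma extract_flip : flip_symmetric r f.
Proof.
move=> mu hmu muf.
have [[a [b [c e]]]|[a [d [s e]]]] := supp_cases n0 hom no_columns muf; last first.
  case: hmu => a1 [b1 [c1]]; rewrite e => -[_].
  by case: b1 c1 => [|b1] [|c1].
have smu := hom muf; rewrite e sumn_hookcol in smu.
have la : (a < M)%N by rewrite /M; lia.
have lb : (b < M)%N by rewrite /M; lia.
have lc : (c < M)%N by rewrite /M; lia.
have := key a (r - 2 + (2 * b + c))%N (Ordinal lc).
rewrite (bigD1 (Ordinal la)) //= [X in _ + X = _ -> _]big1 ?addr0 => [|i ni]; last first.
  by rewrite big1 // => j _; rewrite -[X in X && _]/(nat_of_ord i == Ordinal la) val_eqE (negbTE ni).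
rewrite (bigD1 (Ordinal lb)) //= big1 ?addr0 => [|j nj]; last first.
  rewrite eqxx eqn_add2l eqn_add2r eqn_pmul2l //=.
  by rewrite -[X in _ *+ X]/(nat_of_bool (nat_of_ord j == Ordinal lb)) val_eqE (negbTE nj).
rewrite !eqxx mulr1n /C -e seq_coefE => k.
have [i nzi] := neq0_sum (etrans (esym (congr1 (fun y => y != 0) k)) muf).
have [j] := neq0_sum nzi.
have [/andP[/eqP ei /eqP ej] nz|_] := boolP (_ && _); last by rewrite mulr0n eqxx.
have kE : schur_coef mu f = seq_coef f (hookcol_seq i.+2 j c).
  rewrite k (bigD1 i) //= [X in _ + X]big1 ?addr0 => [|i' ni]; last first.
    rewrite big1 // => j' _; rewrite -ej -[X in _ && X]/(nat_of_ord i' == i) val_eqE (negbTE ni).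
    by rewrite andbF.
  rewrite (bigD1 j) //= big1 ?addr0 => [|j' nj]; last first.
    rewrite -ei eqn_add2l eqn_add2r eqn_pmul2l //.
    by rewrite -[X in X && _]/(nat_of_ord j' == j) val_eqE (negbTE nj).
  by rewrite ei ej !eqxx mulr1n.
have [nu enu] := seq_coef_neq0 (etrans (esym (congr1 (fun y => y != 0) kE)) muf).
exists nu; last by rewrite kE -enu seq_coefE.
exists b, c, (nat_of_ord j); split; first by rewrite e; congr (hookcol_seq _ _ _); lia.
by rewrite enu; congr (hookcol_seq _ _ _); lia.
Qed.

End FlipCriterion.

(** * Plethysm by the Schur functions of degree 2 *)

Lemma newton1 (R : comNzRingType) (P a : nat -> R) : newton P a -> a 1%N = P 1%N.
Proof.
by move=> [a0 aS]; rewrite -[a 1%N]mulr1n aS big_ord_recl big_ord0 addr0 a0 mulr1.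
Qed.

Lemma newton2 (R : comNzRingType) (P a : nat -> R) :
  newton P a -> a 2%N *+ 2 = P 1%N * P 1%N + P 2%N.
Proof.
move=> Ha; rewrite Ha.2 2!big_ord_recl big_ord0 addr0.
by rewrite -[(2 - _)%N]/1%N (newton1 Ha) Ha.1 mulr1.
Qed.

Lemma hsym1 : hsym 1 = psum 1.
Proof. exact: newton1 hsym_newton. Qed.

Lemma hsym2 : hsym 2 = 2%:R^-1 *: (psum 1 * psum 1 + psum 2).
Proof.
have gen (V : lmodType rat) (a b : V) : a *+ 2 = b -> a = 2%:R^-1 *: b.
  by move=> <-; rewrite -[a *+ 2]scaler_nat scalerA mulVf ?scale1r // pnatr_eq0.
by apply: gen; exact: newton2 hsym_newton.
Qed.

Lemma schur_two : schur [:: 2%N] = 2%:R^-1 *: (psum 1 * psum 1 + psum 2).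
Proof. by rewrite /schur det_mx11 mxE hsym2. Qed.

Lemma det2 (R : comNzRingType) (h : nat -> nat -> R) :
  \det (\matrix_(i < 2, j < 2) h i j) = h 0 0 * h 1 1 - h 0 1 * h 1 0.
Proof.
rewrite (expand_det_row _ ord0) !big_ord_recl big_ord0 addr0.
by rewrite /cofactor !det_mx11 !mxE /= /bump /= expr0 expr1 mul1r mulN1r mulrN.
Qed.

Lemma schur_one_one : schur [:: 1%N; 1%N] = 2%:R^-1 *: (psum 1 * psum 1 + (-1) *: psum 2).
Proof.
have -> : schur [:: 1%N; 1%N] = hsym 1 * hsym 1 - hsym 2 * hsym 0.
  exact: (det2 (fun i j : nat => if (i <= nth 0 [:: 1; 1] i + j)%N
    then hsym (nth 0 [:: 1; 1] i + j - i)%N else 0)).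
rewrite hsym1 hsym2 hsym_newton.1.
have gen (V : algType rat) (a b : V) : a - 2%:R^-1 *: (a + b) * 1 = 2%:R^-1 *: (a + (-1) *: b).
  rewrite mulr1 scalerDr [RHS]scalerDr opprD addrA scalerA mulrN1 scaleNr; congr (_ - _).
  by rewrite -{1}[a]scale1r -scalerBl; congr (_ *: _); field.
exact: gen.
Qed.

Lemma padams1 f : padams 1 f = f.
Proof.
by apply: etrans (psubst_psum_id f); apply: eq_psubst => k _; rewrite mul1n.
Qed.

(** With c = 1 and c = -1 these are the plethysms by s_2 and s_(1,1). *)
Lemma plethysm_square (c : rat) f :
  plethysm (2%:R^-1 *: (psum 1 * psum 1 + c *: psum 2)) f = 2%:R^-1 *: (f * f + c *: padams 2 f).
Proof.
have p1 : psubst (padams^~ f) (psum 1) = f := etrans (psubst_psum (k := 1) _ isT) (padams1 f).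
apply: etrans (psubstZ _ _ _) _; congr (_ *: _); apply: etrans (psubstD _ _ _) _.
congr (_ + _); first exact: etrans (psubstM _ _ _) (congr2 *%R p1 p1).
apply: etrans (psubstZ _ _ _) _; apply: (congr1 ( *:%R c)).
exact: (psubst_psum (k := 2) _ isT).
Qed.

Lemma plethysm_two f : plethysm (schur [:: 2%N]) f = square_plethysm false f.
Proof.
have := plethysm_square 1 f; rewrite [1 *: psum 2]scale1r schur_two => ->.
by rewrite /square_plethysm expr0.
Qed.

Lemma plethysm_one_one f : plethysm (schur [:: 1%N; 1%N]) f = square_plethysm true f.
Proof. by rewrite schur_one_one plethysm_square. Qed.

Lemma homogeneous_square_plethysm n sgn f :
  homogeneous n f -> homogeneous (2 * n) (square_plethysm sgn f).
Proof.
move=> Hf; apply: gradedZ; apply: gradedD.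
  by rewrite mul2n -addnn; apply: (gradedM pweightM).
by apply: gradedZ; apply: homogeneous_padams.
Qed.

Lemma super_square_plethysm (R : comNzRingType) (iota : {rmorphism rat -> R}) x e1 e2 sgn f :
  super iota x e1 e2 (square_plethysm sgn f) = iota 2%:R^-1 *
    (super iota x e1 e2 f ^+ 2 + (-1) ^+ sgn * super iota (x ^+ 2) (2%:R * e2 - e1 ^+ 2) (e2 ^+ 2) f).
Proof.
rewrite /square_plethysm superZ; congr (_ * _).
apply: etrans (rmorphD (super iota x e1 e2) _ _) _; congr (_ + _).
  by rewrite expr2; apply: rmorphM.
by apply: etrans (superZ _ _ _ _ _ _) _; rewrite super_padams2 rmorph_sign.
Qed.

Section FlipSquare.
Variables (n r : nat) (f : Lambda) (sgn : bool).
Hypotheses (n0 : (0 < n)%N) (r2 : (2 <= r)%N) (hom_f : homogeneous n f) (flip_f : flip_symmetric r f).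

Let F := square_plethysm sgn f.

(* The flip with offset r >= 2 is defined only on partitions with first part
   at least r. *)
Let no_columns : seq_coef f (nseq n 1%N) = 0.
Proof.
apply/eqP; apply/negPn/negP => nz; have [mu e] := seq_coef_neq0 nz.
rewrite -e seq_coefE in nz.
have eh : mu = hookcol_seq 1 0 n.-1 :> seq nat by rewrite e -(prednK n0).
have [|nu [b [c [d [e1 _]]]] _] := flip_f _ nz; first by exists 1%N, 0%N, n.-1.
by have [] := hookcol_seq_inj (etrans (esym eh) e1); lia.
Qed.

(* The evaluation in a single odd variable y of f * f and of p_2 o f is the
   square of that of f, or that of f at -y^2; both vanish. *)
Let no_columnsF : seq_coef F (nseq (2 * n) 1%N) = 0.
Proof.
have homF (mu : partition) : schur_coef mu F != 0 -> sumn mu = (2 * n)%N.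
  by apply: graded_schur_coef; apply: homogeneous_square_plethysm.
have homf (mu : partition) : schur_coef mu f != 0 -> sumn mu = n by apply: graded_schur_coef.
have col y : super idfun 0 y 0 f = 0 by rewrite (super_columns idfun n0 homf) no_columns /= mul0r.
have n20 : (0 < 2 * n)%N by rewrite muln_gt0.
have := super_columns idfun n20 homF 1; rewrite expr1n mulr1 /= => <-.
have c2 : super idfun (0 ^+ 2) (2%:R * 0 - 1 ^+ 2) (0 ^+ 2) f = 0.
  by rewrite expr0n mulr0 sub0r expr1n col.
by rewrite super_square_plethysm c2 col expr0n mulr0 addr0 mulr0.
Qed.

(** The evaluation of f is x^(r-2) quad x t u Phi with Phi symmetric in x and
    t, and the same holds for the evaluation of F with offset 2 r - 2; then
    the flip symmetry of F is recovered from its evaluation. *)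
Lemma flip_square_plethysm : flip_symmetric (2 * r - 2) F.
Proof.
have homF (mu : partition) : schur_coef mu F != 0 -> sumn mu = (2 * n)%N.
  by apply: graded_schur_coef; apply: homogeneous_square_plethysm.
have homf (mu : partition) : schur_coef mu f != 0 -> sumn mu = n by apply: graded_schur_coef.
have n20 : (0 < 2 * n)%N by rewrite muln_gt0.
have r20 : (2 <= 2 * r - 2)%N by lia.
pose Phi := flip_sum cst f r n.+1.
(* p_2 o f is evaluated at x^2, -t^2, u^2 - 2 in place of x, t, u, and
   quad (x^2) (-t^2) (u^2 - 2) is quad x t u times quad x t (-u). So
   x^(2r-4) quad x t u divides the evaluations of both f * f and p_2 o f. *)
pose G (x t u : {poly {poly {poly rat}}}) := cst 2%:R^-1 * (quad x t u * Phi x t u ^+ 2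
  + (-1) ^+ sgn * (quad x t (- u) * Phi (x ^+ 2) (- t ^+ 2) (u ^+ 2 - 2%:R))).
have quadC (x t u : {poly {poly {poly rat}}}) : quad x t u = quad t x u by rewrite /quad; ring.
have PhiC x t u : Phi x t u = Phi t x u := flip_sumC cst n0 r2 flip_f n.+1 x t u.
apply: (extract_flip n20 homF no_columnsF r20 (G := G)) => x t u.
  rewrite /G quadC [quad x t (- u)]quadC (PhiC x); congr (_ * (_ + _ * (_ * _))).
  have := flip_sumN cst f r n.+1 (- t ^+ 2) (x ^+ 2) (u ^+ 2 - 2%:R).
  by rewrite opprK => eN; apply: etrans (PhiC _ _ _) (esym eN).
have supf y s w : super cst y (s * w) (s ^+ 2) f = y ^+ (r - 2) * quad y s w * Phi y s w.
  have e := super_flip_symmetric cst n0 homf no_columns r2 flip_f y s w (ltnSn n).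
  exact: e.
rewrite super_square_plethysm supf.
have -> : 2%:R * t ^+ 2 - (t * u) ^+ 2 = - t ^+ 2 * (u ^+ 2 - 2%:R) by ring.
have -> : (t ^+ 2) ^+ 2 = (- t ^+ 2) ^+ 2 by rewrite sqrrN.
rewrite supf /G.
have -> : quad (x ^+ 2) (- t ^+ 2) (u ^+ 2 - 2%:R) = quad x t u * quad x t (- u).
  by rewrite /quad; ring.
have -> : x ^+ (2 * r - 2 - 2) = x ^+ (r - 2) ^+ 2 by rewrite -exprM; congr (_ ^+ _); lia.
have -> : x ^+ 2 ^+ (r - 2) = x ^+ (r - 2) ^+ 2 by rewrite -!exprM mulnC.
have gen (R : comNzRingType) (c s X Q Q' A A' : R) :
  c * ((X * Q * A) ^+ 2 + s * (X ^+ 2 * (Q * Q') * A')) =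
  X ^+ 2 * Q * (c * (Q * A ^+ 2 + s * (Q' * A'))) by ring.
exact: gen.
Qed.

End FlipSquare.

(** No hook+column partition has size 0. *)
Lemma flip_symmetric_degree0 r f : homogeneous 0 f -> flip_symmetric r f.
Proof.
move=> Hf mu [a [b [c e]]] nz; have := graded_schur_coef Hf nz.
rewrite e sumn_hookcol => /eqP; rewrite addn_eq0 => /andP[/eqP a0 _].
by have /andP[_] := valP mu; rewrite [\val mu]e a0 inE.
Qed.

Theorem mainTheorem3 (n r : nat) (f : Lambda) :
  (2 <= r)%N ->
  homogeneous n f ->
  schur_positive f ->
  flip_symmetric r f ->
  let f11 := plethysm (schur [:: 1; 1]) f in
  let f2 := plethysm (schur [:: 2]) f in
  (schur_positive f11 /\ homogeneous (2 * n) f11 /\ flip_symmetric (2 * r - 2) f11) /\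
  (schur_positive f2 /\ homogeneous (2 * n) f2 /\ flip_symmetric (2 * r - 2) f2).
Proof.
move=> r2 hom_f pos_f flip_f f11 f2.
have main sgn : schur_positive (square_plethysm sgn f) /\
    homogeneous (2 * n) (square_plethysm sgn f) /\
    flip_symmetric (2 * r - 2) (square_plethysm sgn f).
  split; first exact: square_plethysm_positive hom_f pos_f sgn.
  have hF := @homogeneous_square_plethysm n sgn f hom_f; split=> //.
  case: (posnP n) => [n0|n0]; last exact: flip_square_plethysm sgn n0 r2 hom_f flip_f.
  by apply: flip_symmetric_degree0; rewrite n0 in hF.
by rewrite /f11 /f2 plethysm_one_one plethysm_two; split; apply: main.
Qed.
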